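(* In the setting described in the context, the sequence $$\widetilde{S}_{h,0}(\Omega)\xrightarrow{\ \nabla\ }\mathcal{IND}_{h,0}(\Omega)\xrightarrow{\ \mathrm{curl}\ }Q_h$$ is exact, where $Q_h\subset L^2(\Omega)$ is a space of piecewise constants and both differential operators are taken element by element (piecewise on $T_h^\pm$ on interface elements); namely $$\nabla\widetilde{S}_{h,0}(\Omega)=\{\mathbf{z}_h\in\mathcal{IND}_{h,0}(\Omega):\ \mathrm{curl}\,\mathbf{z}_h=0\}.$$
   Context: $\Omega\subset\mathbb{R}^2$ is a bounded, simply connected polygonal domain; $\Gamma\subset\Omega$ is a smooth simple Jordan curve not touching $\partial\Omega$ that separates $\Omega$ into subdomains $\Omega^-$ and $\Omega^+$. $\mu=\mu^\pm$, $\beta=\beta^\pm$ in $\Omega^\pm$ are positive constants. $\mathrm{curl}\,\mathbf{v}=\partial_{x_1}v_2-\partial_{x_2}v_1$. $\mathcal{T}_h$ is a triangulation of $\Omega$ (not fitted to $\Gamma$) whose triangles have no obtuse angle; $\mathring{\mathcal{E}}_h$ is the set of interior edges. Elements cut by $\Gamma$ are interface elements (collection $\mathcal{T}_h^i$). The mesh is such that $\Gamma$ intersects the boundary of each interface element $T$ at exactly two distinct points, on two different edges; $\Gamma_h^T$ is the segment joining them, it cuts $T$ into $T_h^-$, $T_h^+$ (corresponding to $\Omega^-$, $\Omega^+$); $\bar{\mathbf t},\bar{\mathbf n}$ are unit tangent and normal to $\Gamma_h^T$, $X_m$ is its midpoint. H(curl) IFE space. $\mathcal{ND}_h(K)=\{\mathbf{a}+b[x_2,-x_1]^t:\mathbf{a}\in\mathbb{R}^2,b\in\mathbb{R}\}$.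 On $T\in\mathcal{T}_h^i$, $\mathcal{C}_T:\mathcal{ND}_h(T_h^-)\to\mathcal{ND}_h(T_h^+)$ is the linear bijection determined by $\mathcal{C}_T(\mathbf{v}_h)\cdot\bar{\mathbf{t}}=\mathbf{v}_h\cdot\bar{\mathbf{t}}$, $\frac{1}{\mu^+}\mathrm{curl}\,\mathcal{C}_T(\mathbf{v}_h)=\frac{1}{\mu^-}\mathrm{curl}\,\mathbf{v}_h$, $\beta^+\mathcal{C}_T(\mathbf{v}_h)\cdot\bar{\mathbf{n}}=\beta^-\mathbf{v}_h\cdot\bar{\mathbf{n}}$ at $X_m$, and $\mathcal{IND}_h(T)$ consists of the functions equal to $\mathbf{v}_h$ on $T_h^-$ and $\mathcal{C}_T(\mathbf{v}_h)$ on $T_h^+$, $\mathbf{v}_h\in\mathcal{ND}_h(T_h^-)$. On non-interface elements $\mathcal{IND}_h(T)=\mathcal{ND}_h(T)$. $\mathcal{IND}_h(\Omega)=\{\mathbf{v}\in \mathbf{L}^2(\Omega):\mathbf{v}|_T\in\mathcal{IND}_h(T)\ \forall T,\ \int_e[\mathbf{v}\cdot\mathbf{t}]_e\,ds=0\ \forall e\in\mathring{\mathcal{E}}_h\}$; $\mathcal{IND}_{h,0}(\Omega)$ is its subspace with zero tangential trace on $\partial\Omega$. $H^1$ IFE space. On $T\in\mathcal{T}_h^i$, $\widetilde{S}_h(T)=\{z_h: z_h^\pm=z_h|_{T_h^\pm}\in\mathbb{P}_1(T_h^\pm),\ z_h^+=z_h^-\text{ on }\Gamma_h^T,\ \beta^-\nabla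 z_h^-\cdot\bar{\mathbf n}=\beta^+\nabla z_h^+\cdot\bar{\mathbf n}\}$; on non-interface elements $\widetilde S_h(T)=\mathbb{P}_1(T)$. Functions in $\widetilde S_h(T)$ are uniquely determined by their values at the vertices of $T$. $\widetilde{S}_h(\Omega)$ is the space of functions that are in $\widetilde S_h(T)$ on every $T$ and continuous at every mesh node; $\widetilde{S}_{h,0}(\Omega)$ is its subspace with zero trace on $\partial\Omega$. *)

(* Defs.v *)
From mathcomp Require Import all_boot all_order all_algebra.
From mathcomp Require Import all_classical all_reals all_analysis.

Set Implicit Arguments.
Unset Strict Implicit.
Unset Printing Implicit Defensive.

Import Order.TTheory GRing.Theory Num.Theory.
Import numFieldNormedType.Exports.

Local Open Scope classical_set_scope.
Local Open Scope ring_scope.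

Definition dot {R : realType} (x y : R * R) : R := x.1 * y.1 + x.2 * y.2.

Definition grad {R : realType} (u : R * R -> R) (x : R * R) : R * R :=
  ('D_((1, 0) : R * R) u x, 'D_((0, 1) : R * R) u x).

Definition curl {R : realType} (v : R * R -> R * R) (x : R * R) : R :=
  'D_((1, 0) : R * R) (fun y => (v y).2) x
  - 'D_((0, 1) : R * R) (fun y => (v y).1) x.

Definition lerp {R : realType} (a b : R * R) (s : R) : R * R :=
  a + s *: (b - a).

Definition segment {R : realType} (a b : R * R) : set (R * R) :=
  [set lerp a b s | s in `[0, 1]].

Definition bdry {R : realType} (A : set (R * R)) : set (R * R) :=
  closure A `\` A°.

(* [injective_closed_polygon p] says that the closed polygonal line through
   p_0, ..., p_m (back to p_0) has no self-intersection: its parametrization by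
   half-open sides is injective. *)
Definition injective_closed_polygon {R : realType} (m : nat)
    (p : 'I_m -> R * R) : Prop :=
  forall (i j : 'I_m) (s t : R), 0 <= s < 1 -> 0 <= t < 1 ->
    lerp (p i) (p (ordS i)) s = lerp (p j) (p (ordS j)) t -> i = j /\ s = t.

(* Polygonal domain without holes: a bounded domain whose boundary is a simple
   closed polygon. *)
Definition polygonal_domain {R : realType} (Omega : set (R * R)) : Prop :=
  [/\ open Omega, connected Omega, Omega !=set0, bounded_set Omega
    & exists (m : nat) (p : 'I_m -> R * R), injective_closed_polygon p /\
        bdry Omega = \bigcup_i segment (p i) (p (ordS i))].

(* Used on open connected sets only, so path-connectedness is automatic. *)
Definition simply_connected {R : realType} (Omega : set (R * R)) : Prop :=
  connected Omega /\
  forall gamma : R -> R * R,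
    {within `[0, 1], continuous gamma} -> gamma @` `[0, 1] `<=` Omega ->
    gamma 0 = gamma 1 ->
    exists H : R * R -> R * R,
      [/\ {within `[0, 1] `*` `[0, 1], continuous H},
          H @` (`[0, 1] `*` `[0, 1]) `<=` Omega,
          forall s, 0 <= s <= 1 -> H (s, 0) = gamma s,
          forall s, 0 <= s <= 1 -> H (s, 1) = gamma 0
        & forall t, 0 <= t <= 1 -> H (0, t) = gamma 0 /\ H (1, t) = gamma 0].

(* The parametrization is 1-periodic, C^oo and regular. *)
Definition smooth_jordan_curve {R : realType} (Gamma : set (R * R)) : Prop :=
  exists gamma : R -> R * R,
    [/\ forall t, gamma (t + 1) = gamma t,
        forall (k : nat) (t : R), derivable (derive1n k gamma) t 1,
        forall t, derive1 gamma t <> 0,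
        forall s t, 0 <= s < 1 -> 0 <= t < 1 -> gamma s = gamma t -> s = t
      & Gamma = range gamma].

Definition separates {R : realType} (Gamma Omega Om Op : set (R * R)) : Prop :=
  [/\ open Om /\ open Op, connected Om /\ connected Op,
      Om !=set0 /\ Op !=set0, Om `&` Op = set0
    & Omega `\` Gamma = Om `|` Op].

(* [ptD K], [ptE K] and [nrm K] are only meaningful on interface elements: they
   are the two points of Gamma on the boundary of K and the unit normal of the
   segment joining them, pointing from the minus part to the plus part. *)
Record mesh (R : realType) := Mesh {
  nelt : nat;
  vtx : 'I_nelt -> 'I_3 -> R * R;
  ptD : 'I_nelt -> R * R;
  ptE : 'I_nelt -> R * R;
  nrm : 'I_nelt -> R * R
}.

Definition elt {R : realType} (M : mesh R) (K : 'I_(nelt M)) : set (R * R) :=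
  [set x | exists a : 'I_3 -> R,
    [/\ forall i, 0 <= a i, \sum_i a i = 1 & x = \sum_i a i *: vtx K i]].

(* The edge opposite to vertex i; indices are modulo 3. *)
Definition edge {R : realType} (M : mesh R) (K : 'I_(nelt M)) (i : 'I_3) :
  set (R * R) := segment (vtx K (i + 1)) (vtx K (i - 1)).

Definition triangulation {R : realType} (M : mesh R) (Omega : set (R * R)) :
    Prop :=
  [/\ forall K : 'I_(nelt M),
        let a := vtx K 1 - vtx K 0 in let b := vtx K 2 - vtx K 0 in
        a.1 * b.2 - a.2 * b.1 <> 0,
      closure Omega = \bigcup_(K : 'I_(nelt M)) elt K
    & forall K L : 'I_(nelt M), K <> L ->
        [\/ elt K `&` elt L = set0,
            exists i j, vtx K i = vtx L j /\
                        elt K `&` elt L = [set vtx K i]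
          | exists i j, edge K i = edge L j /\
                        elt K `&` elt L = edge K i]].

Definition no_obtuse_angle {R : realType} (M : mesh R) : Prop :=
  forall (K : 'I_(nelt M)) (i : 'I_3),
    0 <= dot (vtx K (i + 1) - vtx K i) (vtx K (i - 1) - vtx K i).

Definition interface_elt {R : realType} (M : mesh R) (Gamma : set (R * R))
    (K : 'I_(nelt M)) : Prop :=
  (elt K)° `&` Gamma !=set0.

Definition cut_segment {R : realType} (M : mesh R) (K : 'I_(nelt M)) :
  set (R * R) := segment (ptD K) (ptE K).

Definition cut_tangent {R : realType} (M : mesh R) (K : 'I_(nelt M)) : R * R :=
  (- (nrm K).2, (nrm K).1).

Definition cut_midpoint {R : realType} (M : mesh R) (K : 'I_(nelt M)) : R * R :=
  lerp (ptD K) (ptE K) 2^-1.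

(* Signed distance to the line through [ptD K] and [ptE K]. *)
Definition cut_dist {R : realType} (M : mesh R) (K : 'I_(nelt M))
    (x : R * R) : R := dot (x - ptD K) (nrm K).

(* The intersection points lie on two different edges in the sense that no edge
   contains both (a point may be a vertex), so that the segment really cuts the
   element.  The last two conditions say that the two parts correspond to the
   two subdomains; closures are needed for vertices on the outer boundary. *)
Definition cut_by_interface {R : realType} (M : mesh R)
    (Gamma Om Op : set (R * R)) : Prop :=
  forall K : 'I_(nelt M), interface_elt Gamma K ->
    [/\ ptD K <> ptE K /\
          Gamma `&` (\bigcup_i edge K i) = [set ptD K; ptE K],
        forall i, ~ (edge K i (ptD K) /\ edge K i (ptE K)),
        dot (nrm K) (nrm K) = 1 /\ dot (ptE K - ptD K) (nrm K) = 0,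
        forall i, cut_dist K (vtx K i) < 0 -> closure Om (vtx K i)
      & forall i, 0 < cut_dist K (vtx K i) -> closure Op (vtx K i)].

(* Elements of L^2(Omega) are represented by functions on the plane, of which
   only the values on [pieces], i.e. outside the mesh skeleton and the cut
   segments (a null set), are ever used: traces are limits from inside an
   element.  The functions considered being piecewise polynomial on finitely
   many bounded pieces, they are automatically square integrable. *)

(* The interior of K, deprived of the cut segment if K is an interface
   element. *)
Definition pieces {R : realType} (M : mesh R) (Gamma : set (R * R))
    (K : 'I_(nelt M)) : set (R * R) :=
  [set x | (elt K)° x /\ (interface_elt Gamma K -> cut_dist K x <> 0)].

Definition eq_pieces {R : realType} (M : mesh R) (Gamma : set (R * R))
    (U : Type) (v w : R * R -> U) : Prop :=
  forall (K : 'I_(nelt M)) (x : R * R), pieces Gamma K x -> v x = w x.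

(* [v] is [vm] on the minus part and [vp] on the plus part of K. *)
Definition glued {R : realType} (M : mesh R) (K : 'I_(nelt M)) (U : Type)
    (v vm vp : R * R -> U) : Prop :=
  forall x, (elt K)° x ->
    (cut_dist K x < 0 -> v x = vm x) /\ (0 < cut_dist K x -> v x = vp x).

Definition trace {R : realType} (M : mesh R) (Gamma : set (R * R))
    (U : normedModType R) (K : 'I_(nelt M)) (v : R * R -> U) (x : R * R) : U :=
  lim (v y @[y --> within (pieces Gamma K) (nbhs x)]).

Definition piecewise_const {R : realType} (M : mesh R) (Gamma : set (R * R))
    (q : R * R -> R) : Prop :=
  forall K : 'I_(nelt M),
    (interface_elt Gamma K -> exists cm cp : R, glued K q (cst cm) (cst cp)) /\
    (~ interface_elt Gamma K ->
       exists c : R, forall x, (elt K)° x -> q x = c).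

Definition ND {R : realType} (v : R * R -> R * R) : Prop :=
  exists (a : R * R) (b : R), forall x, v x = a + b *: (x.2, - x.1).

(* The graph of the map C_T: [vp] is the image of [vm]. *)
Definition CT {R : realType} (M : mesh R) (mum mup bm bp : R)
    (K : 'I_(nelt M)) (vm vp : R * R -> R * R) : Prop :=
  [/\ forall x, cut_segment K x ->
        dot (vp x) (cut_tangent K) = dot (vm x) (cut_tangent K),
      forall x, mup^-1 * curl vp x = mum^-1 * curl vm x
    & bp * dot (vp (cut_midpoint K)) (nrm K) =
      bm * dot (vm (cut_midpoint K)) (nrm K)].

Definition IND_loc {R : realType} (M : mesh R) (Gamma : set (R * R))
    (mum mup bm bp : R) (K : 'I_(nelt M)) (v : R * R -> R * R) : Prop :=
  (interface_elt Gamma K -> exists vm vp,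
     [/\ ND vm, ND vp, CT mum mup bm bp K vm vp & glued K v vm vp]) /\
  (~ interface_elt Gamma K ->
     exists w, ND w /\ forall x, (elt K)° x -> v x = w x).

(* The integral over the edge [A, B] of the tangential jump between K and L,
   with the parametrization s |-> A + s (B - A), for which t ds = (B - A) ds. *)
Definition edge_jump {R : realType} (M : mesh R) (Gamma : set (R * R))
    (K L : 'I_(nelt M)) (i : 'I_3) (v : R * R -> R * R) : R :=
  let A := vtx K (i + 1) in let B := vtx K (i - 1) in
  \int[lebesgue_measure]_(s in `[0, 1])
     dot (trace Gamma K v (lerp A B s) - trace Gamma L v (lerp A B s)) (B - A).

(* The interior edges are those shared by two elements. *)
Definition IND {R : realType} (M : mesh R) (Gamma : set (R * R))
    (mum mup bm bp : R) (v : R * R -> R * R) : Prop :=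
  (forall K : 'I_(nelt M), IND_loc Gamma mum mup bm bp K v) /\
  (forall (K L : 'I_(nelt M)) (i j : 'I_3),
     K <> L -> edge K i = edge L j -> edge_jump Gamma K L i v = 0).

Definition IND0 {R : realType} (M : mesh R) (Omega Gamma : set (R * R))
    (mum mup bm bp : R) (v : R * R -> R * R) : Prop :=
  IND M Gamma mum mup bm bp v /\
  (forall (K : 'I_(nelt M)) (i : 'I_3), edge K i `<=` bdry Omega ->
     forall x, edge K i x ->
       dot (trace Gamma K v x) (vtx K (i - 1) - vtx K (i + 1)) = 0).

Definition P1 {R : realType} (z : R * R -> R) : Prop :=
  exists (c : R) (g : R * R), forall x, z x = c + dot g x.

Definition Sh_loc {R : realType} (M : mesh R) (Gamma : set (R * R))
    (bm bp : R) (K : 'I_(nelt M)) (z : R * R -> R) : Prop :=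
  (interface_elt Gamma K -> exists zm zp,
     [/\ P1 zm, P1 zp,
         forall x, cut_segment K x -> zp x = zm x,
         forall x, cut_segment K x ->
           bm * dot (grad zm x) (nrm K) = bp * dot (grad zp x) (nrm K)
       & glued K z zm zp]) /\
  (~ interface_elt Gamma K ->
     exists w, P1 w /\ forall x, (elt K)° x -> z x = w x).

(* Continuity is required at the mesh nodes only. *)
Definition Sh {R : realType} (M : mesh R) (Gamma : set (R * R))
    (bm bp : R) (z : R * R -> R) : Prop :=
  (forall K : 'I_(nelt M), Sh_loc Gamma bm bp K z) /\
  (forall (K L : 'I_(nelt M)) (i j : 'I_3), vtx K i = vtx L j ->
     trace Gamma K (z : R * R -> R^o) (vtx K i)
     = trace Gamma L (z : R * R -> R^o) (vtx K i)).

Definition Sh0 {R : realType} (M : mesh R) (Omega Gamma : set (R * R))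
    (bm bp : R) (z : R * R -> R) : Prop :=
  Sh M Gamma bm bp z /\
  (forall (K : 'I_(nelt M)) (i : 'I_3), edge K i `<=` bdry Omega ->
     forall x, edge K i x -> trace Gamma K (z : R * R -> R^o) x = 0).

(* Main.v *)
(* Elementwise, both spaces have the same normal form: the tangential and flux
   conditions say that a curl-free z is the gradient of a continuous function
   W_K = g.x + al max(d, 0), where d is the distance to the cut line, and then
   the tangential integral of z over an edge is a difference of values of W_K.
   So only a discrete statement remains: a closed 1-cochain on the mesh edges
   that vanishes on the boundary edges is the coboundary of a nodal function
   that vanishes on the boundary.

   Replace W_K by its linear interpolant, with gradient w_K.  Near each point
   [a], the function equal to w_K.(x - a) on the elements K containing a, and to
   0 outside the domain, is a local potential of the field extended by 0 to the
   plane.  By a Lebesgue number argument its increments form a cocycle c(x, y)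
   for |x - y| small, and summing c along subdivided rays from the origin gives
   a global potential, which is constant along the boundary polygon because the
   latter is connected.

   Extension by 0 requires that the boundary polygon be covered by mesh edges
   contained in it.  This uses the part of the Jordan curve theorem proved by
   parity of ray crossings: near a generic boundary point, the domain is not on
   both sides. *)
Require Import Defs.
From mathcomp Require Import all_boot all_order all_algebra.
From mathcomp Require Import all_classical all_reals all_analysis.
From mathcomp Require Import ring lra.
Import Order.TTheory GRing.Theory Num.Theory.
Import numFieldNormedType.Exports.
Local Open Scope classical_set_scope.
Local Open Scope ring_scope.

Set Implicit Arguments.
Unset Strict Implicit.
Unset Printing Implicit Defensive.

(** * Plane geometry *)

Lemma ord3P (i : 'I_3) : [\/ i = 0, i = 1 | i = 2].
Proof.
case: i => [[|[|[|//]]] h]; [apply: Or31|apply: Or32|apply: Or33]; exact/val_inj.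
Qed.

Lemma sum_ord3 (V : nmodType) (F : 'I_3 -> V) : \sum_i F i = F 0 + F 1 + F 2.
Proof.
rewrite !big_ord_recl big_ord0 addr0 addrA.
by congr (_ + F _ + F _); apply/val_inj.
Qed.

Lemma ord3E : [/\ 0 + 1 = 1 :> 'I_3, 0 - 1 = 2 :> 'I_3, 1 + 1 = 2 :> 'I_3,
  1 - 1 = 0 :> 'I_3 & (2 + 1 = 0 :> 'I_3) /\ (2 - 1 = 1 :> 'I_3)].
Proof. by split; rewrite ?subrr //; try split; apply/val_inj. Qed.

Ltac ord3_case i :=
  let H1 := fresh in let H2 := fresh in let H3 := fresh in
  let H4 := fresh in let H5 := fresh in let H6 := fresh in
  have [H1 H2 H3 H4 [H5 H6]] := ord3E;
  have [] := ord3P i => ->; rewrite ?(H1, H2, H3, H4, H5, H6);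
  clear H1 H2 H3 H4 H5 H6.

Lemma sum_ord3_cyclic (V : nmodType) (F : 'I_3 -> V) (i : 'I_3) :
  \sum_j F j = F i + F (i + 1) + F (i - 1).
Proof.
rewrite sum_ord3; ord3_case i => //; first by rewrite -addrA addrC.
by rewrite addrC addrA.
Qed.

Lemma ord3_neq (i : 'I_3) : [/\ i + 1 != i, i - 1 != i & i + 1 != i - 1].
Proof. by ord3_case i. Qed.

Lemma ord3_cyclic (i k : 'I_3) : [\/ k = i, k = i + 1 | k = i - 1].
Proof.
ord3_case i; have [] := ord3P k => ->;
  first [exact: Or31 | exact: Or32 | exact: Or33].
Qed.

Section plane.
Variable R : realType.
Implicit Types (x y a b g : R * R) (f : R * R -> R).

Lemma pairP x y : x.1 = y.1 -> x.2 = y.2 -> x = y.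
Proof. by case: x y => [? ?] [? ?] /= -> ->. Qed.

Definition det2 x y : R := x.1 * y.2 - x.2 * y.1.

Lemma dotDr g x y : dot g (x + y) = dot g x + dot g y.
Proof. rewrite /dot /=; ring. Qed.
Lemma dotBr g x y : dot g (x - y) = dot g x - dot g y.
Proof. rewrite /dot /=; ring. Qed.
Lemma dotZr g t x : dot g (t *: x) = t * dot g x.
Proof. rewrite /dot /= /GRing.scale /=; ring. Qed.
Lemma dotDl g h x : dot (g + h) x = dot g x + dot h x.
Proof. rewrite /dot /=; ring. Qed.
Lemma dotZl t g x : dot (t *: g) x = t * dot g x.
Proof. rewrite /dot /= /GRing.scale /=; ring. Qed.
Lemma dotBl g h x : dot (g - h) x = dot g x - dot h x.
Proof. rewrite /dot /=; ring. Qed.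
Lemma dotC x y : dot x y = dot y x.
Proof. rewrite /dot /=; ring. Qed.
Lemma dot0l x : dot 0 x = 0.
Proof. rewrite /dot /=; ring. Qed.
Lemma dot0r x : dot x 0 = 0.
Proof. rewrite /dot /=; ring. Qed.

Lemma lerp0 a b : lerp a b 0 = a.
Proof. by rewrite /lerp scale0r addr0. Qed.
Lemma lerp1 a b : lerp a b 1 = b.
Proof. by rewrite /lerp scale1r addrC subrK. Qed.
Lemma lerpE a b (s : R) : lerp a b s = (1 - s) *: a + s *: b.
Proof. by apply: pairP; rewrite /lerp /= /GRing.scale /=; ring. Qed.
Lemma lerpB a b (s t : R) : lerp a b s - lerp a b t = (s - t) *: (b - a).
Proof. by apply: pairP; rewrite /lerp /= /GRing.scale /=; ring. Qed.

Lemma P1_lerp f a b (s : R) : P1 f -> f (lerp a b s) = (1 - s) * f a + s * f b.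
Proof. by move=> [c [g fE]]; rewrite !fE lerpE dotDr !dotZr; ring. Qed.

Lemma P1_sum3 f (l : 'I_3 -> R) (v : 'I_3 -> R * R) : P1 f ->
  \sum_i l i = 1 -> f (\sum_i l i *: v i) = \sum_i l i * f (v i).
Proof.
move=> [c [g fE]]; rewrite fE !sum_ord3 !fE !dotDr !dotZr => h.
rewrite -[c in LHS]mul1r -h; ring.
Qed.

Lemma dot_continuous g : continuous (fun x => dot g x).
Proof.
move=> x; apply: cvgD; (apply: cvgM; first exact: cvg_cst).
  exact: cvg_fst.
exact: cvg_snd.
Qed.

Lemma P1_continuous f : P1 f -> continuous f.
Proof.
move=> [c [g /funext ->]] x.
by apply: cvgD; [exact: cvg_cst|exact: dot_continuous].
Qed.

Lemma ball0_half (r : R) : 0 < r -> ball (0 : R) r (r / 2) /\ ball (0 : R) r (- (r / 2)).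
Proof.
move=> r0; have h : `|r / 2| < r.
  by rewrite gtr0_norm ?divr_gt0// ltr_pdivrMr// ltr_pMr// ltr1n.
by split; rewrite /ball /= sub0r ?opprK// normrN.
Qed.

Lemma near_gt (T : topologicalType) (f : T -> R) (x : T) (c : R) :
  {for x, continuous f} -> c < f x -> \forall y \near x, c < f y.
Proof. by move=> fc h; exact: (fc _ (lt_nbhsr h)). Qed.

Lemma near_lt (T : topologicalType) (f : T -> R) (x : T) (c : R) :
  {for x, continuous f} -> f x < c -> \forall y \near x, f y < c.
Proof. by move=> fc h; exact: (fc _ (lt_nbhsl h)). Qed.

Lemma lerp_continuous a b : continuous (lerp a b).
Proof.
move=> s; apply: cvgD; first exact: cvg_cst.
by apply: cvgZr_tmp; exact: cvg_id.
Qed.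

Lemma segment_left a b : segment a b a.
Proof. by exists 0; rewrite ?lerp0 //= in_itv /= lexx ler01. Qed.
Lemma segment_right a b : segment a b b.
Proof. by exists 1; rewrite ?lerp1 //= in_itv /= lexx ler01. Qed.

(** Unless the segment is a point, [b - a] and [d - c] are multiples of each other; the factors have
    product 1 and lie in [-1, 1], so [t - s] is 1 or -1. Shared edges are compared as sets, and this
    recovers their vertices up to order. *)
Lemma segment_ends a b c d : segment a b = segment c d ->
  a = c /\ b = d \/ a = d /\ b = c.
Proof.
move=> E.
have [s + sE] : segment c d a by rewrite -E; exact: segment_left.
have [t + tE] : segment c d b by rewrite -E; exact: segment_right.
have [s' + s'E] : segment a b c by rewrite E; exact: segment_left.
have [t' + t'E] : segment a b d by rewrite E; exact: segment_right.
rewrite /= !in_itv /= => /andP[t0 t1] /andP[s0 s1] /andP[u0 u1] /andP[v0 v1].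
have [ab|ab] := eqVneq a b.
  have e r : lerp a b r = a by rewrite /lerp -ab subrr scaler0 addr0.
  by left; rewrite -s'E -t'E !e.
have h1 : b - a = (t - s) *: (d - c) by rewrite -lerpB tE sE.
have h2 : d - c = (t' - s') *: (b - a) by rewrite -lerpB t'E s'E.
have ts1 : (t - s) * (t' - s') = 1.
  have : b - a = ((t - s) * (t' - s')) *: (b - a) by rewrite -scalerA -h2.
  move/eqP; rewrite -subr_eq0 -{1}[b - a]scale1r -scalerBl scaler_eq0.
  by rewrite !subr_eq0 (eq_sym b) (negPf ab) orbF => /eqP <-.
have [[r1 r2]|[r1 r2]] : (t = 1 /\ s = 0) \/ (t = 0 /\ s = 1).
- have [h|h] := lerP 0 (t - s); [left|right]; split; nra.
- by left; rewrite -sE -tE r1 r2 lerp0 lerp1.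
- by right; rewrite -sE -tE r1 r2 lerp0 lerp1.
Qed.
End plane.

(** * Barycentric coordinates *)

Section barycentric.
Variables (R : realType) (M : mesh R).
Implicit Types (K L : 'I_(nelt M)) (i j : 'I_3) (x y a b : R * R).

Definition orient K : R := det2 (vtx K 1 - vtx K 0) (vtx K 2 - vtx K 0).

(** The barycentric coordinate attached to vertex [i], as a quotient of signed areas; being defined
    on the whole plane, it also tells on which side of an edge line a point lies. *)
Definition bary K i x : R :=
  det2 (vtx K (i - 1) - vtx K (i + 1)) (x - vtx K (i + 1)) / orient K.

Hypothesis nd : forall K, orient K != 0.

Lemma bary_P1 K i : P1 (bary K i).
Proof.
set e := vtx K (i - 1) - vtx K (i + 1).
exists (- det2 e (vtx K (i + 1)) / orient K),
  ((- e.2 / orient K, e.1 / orient K) : R * R) => x.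
by rewrite /bary -/e /det2 /dot /=; field; exact: nd.
Qed.

Lemma bary_sum1 K x : \sum_i bary K i x = 1.
Proof.
rewrite sum_ord3 /bary; have [-> -> -> -> [-> ->]] := ord3E.
have := nd K; rewrite /orient /det2 /= => h; field; exact: h.
Qed.

Lemma bary_rec K x : x = \sum_i bary K i x *: vtx K i.
Proof.
rewrite sum_ord3 /bary; have [-> -> -> -> [-> ->]] := ord3E.
have := nd K; rewrite /orient /det2 /= => h.
by apply: pairP; rewrite /= /GRing.scale /=; field; exact: h.
Qed.

Lemma bary_vtx K i j : bary K i (vtx K j) = (i == j)%:R.
Proof.
have := nd K; rewrite /bary /orient /det2 /= => h.
by ord3_case i; have [] := ord3P j => -> /=; field; exact: h.
Qed.

Lemma P1_bary f K x : P1 f -> f x = \sum_i bary K i x * f (vtx K i).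
Proof. by move=> fP; rewrite {1}(bary_rec K x) P1_sum3// bary_sum1. Qed.

Lemma eltP K x : elt K x <-> forall i, 0 <= bary K i x.
Proof.
split=> [[l [l0 l1 ->]] i|h]; last first.
  by exists (bary K ^~ x); split=> //; [exact: bary_sum1|exact: bary_rec].
rewrite P1_sum3//; last exact: bary_P1.
by apply: sumr_ge0 => j _; rewrite bary_vtx mulr_ge0// ler0n.
Qed.

Lemma edgeP K i x : edge K i x <-> elt K x /\ bary K i x = 0.
Proof.
have [n1 n2 n3] := ord3_neq i.
split=> [[s /=]|[/eltP xK xi]].
  rewrite in_itv /= => /andP[s0 s1] <-; rewrite eltP.
  have E k : bary K k (lerp (vtx K (i + 1)) (vtx K (i - 1)) s) =
      (1 - s) * (k == i + 1)%:R + s * (k == i - 1)%:R.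
    by rewrite P1_lerp ?bary_vtx//; exact: bary_P1.
  split=> [k|]; last by rewrite E !(eq_sym i) (negPf n1) (negPf n2) !mulr0 addr0.
  by rewrite E addr_ge0// mulr_ge0// ?ler0n// subr_ge0.
have s1 := bary_sum1 K x; rewrite (sum_ord3_cyclic _ i) xi add0r in s1.
exists (bary K (i - 1) x).
  rewrite /= in_itv /= xK /= -s1 lerDr; exact: xK.
rewrite lerpE [RHS](bary_rec K) (sum_ord3_cyclic _ i) xi scale0r add0r -s1.
by rewrite addrK.
Qed.

Lemma vtx_elt K i : elt K (vtx K i).
Proof. by apply/eltP => j; rewrite bary_vtx ler0n. Qed.

Lemma edge_elt K i : edge K i `<=` elt K.
Proof. by move=> x /edgeP[]. Qed.

Lemma elt_lerp K x y (s : R) : 0 <= s <= 1 -> elt K x -> elt K y ->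
  elt K (lerp x y s).
Proof.
move=> /andP[s0 s1] /eltP hx /eltP hy; apply/eltP => i.
rewrite P1_lerp; last exact: bary_P1.
by rewrite addr_ge0// mulr_ge0// subr_ge0.
Qed.

Lemma bary_continuous K i : continuous (bary K i).
Proof. exact/P1_continuous/bary_P1. Qed.

Lemma closed_ge0 (f : R * R -> R) : continuous f -> closed [set x | 0 <= f x].
Proof.
move=> fc; rewrite (_ : mkset _ = f @^-1` [set r | 0 <= r]) //.
by apply: preimage_closed => //; exact: closed_ge.
Qed.

Lemma elt_closed K : closed (elt K).
Proof.
rewrite (_ : elt K = \bigcap_i [set x | 0 <= bary K i x]).
  by apply: closed_bigI => i _; apply: closed_ge0; exact: bary_continuous.
apply/seteqP; split=> x; first by move=> /eltP h i _; exact: h.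
by move=> h; apply/eltP => i; exact: h.
Qed.

Lemma edge_closed K i : closed (edge K i).
Proof.
rewrite (_ : edge K i = elt K `&` [set x | 0 <= - bary K i x]).
  apply: closedI; first exact: elt_closed.
  by apply: closed_ge0 => x; apply: cvgN; exact: bary_continuous.
apply/seteqP; split=> x.
  by move=> /edgeP[xK h]; split=> //=; rewrite h oppr0.
move=> [xK /=]; rewrite oppr_ge0 => h; apply/edgeP; split=> //.
by apply/eqP; rewrite eq_le h; move/eltP : xK => ->.
Qed.

Lemma interior_eltP K x : (elt K)° x <-> forall i, 0 < bary K i x.
Proof.
split=> [xK i|h].
  have xK' := interior_subset xK.
  rewrite lt_neqAle eq_sym; apply/andP; split; last by move/eltP : xK' => ->.
  apply/negP => /eqP xi.
  (* Small negative parameters move [x] away from vertex [i]: coordinate [i] turns negative,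
     although the point should still be in [K]. *)
  pose g t := lerp x (vtx K i) t.
  have : \forall t \near (0 : R), elt K (g t).
    have /(_ (elt K)) := @lerp_continuous R x (vtx K i) 0.
    by rewrite lerp0; exact.
  move=> /nbhs_ballP[e /= e0 H].
  have {H} /eltP/(_ i) := H _ (ball0_half e0).2.
  rewrite /g P1_lerp; last exact: bary_P1.
  by rewrite bary_vtx eqxx xi mulr0 add0r mulr1 oppr_ge0 leNgt divr_gt0.
suff : \forall y \near x, forall i, 0 < bary K i y.
  by apply: filterS => y hy; apply/eltP => i; exact: ltW.
have h1 i : \forall y \near nbhs x, 0 < bary K i y.
  exact: (near_gt (@bary_continuous K i x) (h i)).
exact: (@filter_forall _ _ _ (nbhs x) _ h1).
Qed.

Lemma interior_edge K i x : (elt K)° x -> ~ edge K i x.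
Proof. by move=> /interior_eltP/(_ i) h /edgeP[_ e]; rewrite e ltxx in h. Qed.

Lemma edgeS K i : edge K i (vtx K (i + 1)) /\ edge K i (vtx K (i - 1)).
Proof. by split; [exact: segment_left|exact: segment_right]. Qed.

Lemma vtx_edge K i : exists j, edge K j (vtx K i).
Proof.
by exists (i - 1); have := (edgeS K (i - 1)).1; rewrite subrK.
Qed.

Lemma barycenter_interior K : exists x, (elt K)° x.
Proof.
exists (\sum_i 3^-1 *: vtx K i); apply/interior_eltP => i.
rewrite P1_sum3; [|exact: bary_P1|]; last by rewrite sum_ord3; field.
rewrite (sum_ord3_cyclic _ i) !bary_vtx eqxx.
have [+ + _] := ord3_neq i; rewrite !(eq_sym _ i) => /negPf -> /negPf ->.
by rewrite !mulr0 !addr0 mulr1 invr_gt0.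
Qed.

Lemma interior_lerp K x y (t : R) : 0 < t <= 1 -> elt K x -> (elt K)° y ->
  (elt K)° (lerp x y t).
Proof.
move=> /andP[t0 t1] /eltP hx /interior_eltP hy; apply/interior_eltP => i.
rewrite P1_lerp; last exact: bary_P1.
by apply: ltr_wpDl; [rewrite mulr_ge0// subr_ge0|rewrite mulr_gt0].
Qed.

End barycentric.

(** * Parity of ray crossings of a polygon *)

Section parity.
Variables (R : realType) (b : bool).
Implicit Types (a q x y : R * R).

(* [b] chooses the coordinate that serves as abscissa: a side parallel to one
   axis is treated with the other choice. *)
Definition cx q : R := if b then q.1 else q.2.
Definition cy q : R := if b then q.2 else q.1.

Lemma cxyP x y : cx x = cx y -> cy x = cy y -> x = y.
Proof. by rewrite /cx /cy; case: b => *; exact: pairP. Qed.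

Lemma cx_P1 : P1 cx.
Proof.
by exists 0, (if b then (1, 0) else (0, 1)) => x; rewrite /cx /dot; case: b => /=; ring.
Qed.

Lemma cy_P1 : P1 cy.
Proof.
by exists 0, (if b then (0, 1) else (1, 0)) => x; rewrite /cy /dot; case: b => /=; ring.
Qed.

Definition chi a q : bool := cx a <= cx q.

(** For ends of different abscissas, this is the height of [q] above the line through them, times
    the square of [cx a' - cx a]: its sign tells below from above whichever end comes first. *)
Definition line_eq a a' q : R :=
  (cx a' - cx a) *
  ((cx a' - cx a) * (cy q - cy a) - (cy a' - cy a) * (cx q - cx a)).

(* The ray from [q] in the direction of increasing [cy] meets the side, from
   which the end of larger abscissa is removed. *)
Definition crosses a a' q : bool :=
  (chi a q (+) chi a' q) && (line_eq a a' q < 0).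

Lemma line_eq_P1 a a' : P1 (line_eq a a').
Proof.
have [c [g gE]] := cx_P1; have [d [h hE]] := cy_P1.
set dx := cx a' - cx a; set dy := cy a' - cy a.
exists (dx * (dx * (d - cy a) - dy * (c - cx a))),
  (dx *: (dx *: h - dy *: g)) => q.
by rewrite /line_eq -/dx -/dy hE gE dotZl dotBl !dotZl; ring.
Qed.

Let cxc : continuous cx := P1_continuous cx_P1.

Lemma chi_near a q : cx a != cx q -> \forall x \near q, chi a x = chi a q.
Proof.
move=> aq; rewrite /chi; have [h|h] := leP (cx a) (cx q).
  have {}h : cx a < cx q by rewrite lt_neqAle aq.
  by apply: filterS (near_gt (@cxc q) h) => x /ltW ->.
by apply: filterS (near_lt (@cxc q) h) => x; rewrite leNgt => ->.
Qed.

Lemma line_eq_segment a a' q : chi a q != chi a' q -> line_eq a a' q = 0 ->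
  segment a a' q.
Proof.
rewrite /chi /line_eq => hchi e.
set dx := cx a' - cx a in e *.
have dx0 : dx != 0.
  by apply/eqP => /subr0_eq dx0; move: hchi; rewrite dx0 eqxx.
have {}e : dx * (cy q - cy a) = (cy a' - cy a) * (cx q - cx a).
  by apply/subr0_eq; move: e => /eqP; rewrite mulf_eq0 (negPf dx0) => /eqP.
exists ((cx q - cx a) / dx).
  rewrite /= in_itv /=; move: hchi; rewrite /dx.
  case: (leP (cx a) (cx q)); case: (leP (cx a') (cx q)) => // h1 h2 _.
    have d0 : 0 < dx by rewrite /dx; lra.
    by rewrite ler_pdivlMr// ler_pdivrMr// mul0r mul1r; apply/andP; split; lra.
  have d0 : dx < 0 by rewrite /dx; lra.
  by rewrite ler_ndivlMr// ler_ndivrMr// mul0r mul1r; apply/andP; split; lra.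
apply: cxyP; rewrite P1_lerp; [|exact: cx_P1| |exact: cy_P1].
  by move: dx0; rewrite /dx => dx0; field.
have -> : cy q = cy a + (cy a' - cy a) * (cx q - cx a) / dx.
  by rewrite -e; field.
by field.
Qed.

(** If the abscissa of [q] is not between those of the ends, neither are nearby ones. Otherwise
    [line_eq] is nonzero at [q], which is off the side, and keeps its sign nearby. *)
Lemma crosses_near_generic a a' q : cx a != cx q -> cx a' != cx q ->
  ~ segment a a' q -> \forall x \near q, crosses a a' x = crosses a a' q.
Proof.
move=> aq a'q seg; have n1 := chi_near aq; have n2 := chi_near a'q.
have [e|ne] := eqVneq (chi a q) (chi a' q).
  apply: filterS2 n1 n2 => x e1 e2.
  by rewrite /crosses e1 e2 e addbb.
have lc : {for q, continuous (line_eq a a')}.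
  exact: P1_continuous (line_eq_P1 a a') q.
have : line_eq a a' q != 0 by apply/eqP => /(line_eq_segment ne).
rewrite neq_lt => /orP[] h.
  have n3 := near_lt lc h.
  by apply: filterS3 n1 n2 n3 => x e1 e2 e3; rewrite /crosses e1 e2 e3 h.
have n3 := near_gt lc h.
apply: filterS3 n1 n2 n3 => x e1 e2 e3; rewrite /crosses e1 e2.
by rewrite ltNge (ltW e3) ltNge (ltW h).
Qed.

Lemma line_eq_left a a' q : cx q = cx a ->
  line_eq a a' q = (cx a' - cx a) ^+ 2 * (cy q - cy a).
Proof. by rewrite /line_eq => ->; ring. Qed.

Lemma line_eq_right a a' q : cx q = cx a' ->
  line_eq a a' q = (cx a' - cx a) ^+ 2 * (cy q - cy a').
Proof. by rewrite /line_eq => ->; ring. Qed.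

Lemma line_eq_sign a a' q (r : R) : cx a' != cx a -> r != 0 ->
  line_eq a a' q = (cx a' - cx a) ^+ 2 * r ->
  \forall x \near q, (line_eq a a' x < 0) = (r < 0).
Proof.
move=> aa r0 e.
have d0 : 0 < (cx a' - cx a) ^+ 2.
  by rewrite exprn_even_gt0//= subr_eq0.
have lc : {for q, continuous (line_eq a a')}.
  exact: P1_continuous (line_eq_P1 a a') q.
move: r0; rewrite neq_lt => /orP[] r0.
  have h : line_eq a a' q < 0 by rewrite e pmulr_rlt0.
  by apply: filterS (near_lt lc h) => x ->; rewrite r0.
have h : 0 < line_eq a a' q by rewrite e pmulr_rgt0.
by apply: filterS (near_gt lc h) => x hx; rewrite ltNge (ltW hx) ltNge (ltW r0).
Qed.

(* Moving [x] past the abscissa of an end of the side changes the crossing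
   exactly if that end is above; these corrections cancel along a closed
   polygon, each vertex being an end of two sides. *)
Definition vertex_corr a q x : bool :=
  (chi a x (+) chi a q) && (cy q < cy a).

Lemma crosses_near a a' q : ~ segment a a' q ->
  \forall x \near q, crosses a a' x =
    crosses a a' q (+) vertex_corr a q x (+) vertex_corr a' q x.
Proof.
move=> seg; rewrite /vertex_corr.
have na : cx a = cx q -> cy q - cy a != 0.
  move=> e; apply/negP; rewrite subr_eq0 => /eqP e'; apply: seg.
  by rewrite -(cxyP e (esym e')); exact: segment_left.
have na' : cx a' = cx q -> cy q - cy a' != 0.
  move=> e; apply/negP; rewrite subr_eq0 => /eqP e'; apply: seg.
  by rewrite -(cxyP e (esym e')); exact: segment_right.
have [aq|aq] := eqVneq (cx a) (cx q); have [a'q|a'q] := eqVneq (cx a') (cx q).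
- have e x : chi a' x = chi a x by rewrite /chi aq a'q.
  (* Both ends share the abscissa of [q]; if [q] were between them it would be on the side. So the
     two corrections are equal and cancel. *)
  have -> : (cy q < cy a) = (cy q < cy a').
    apply/idP/idP => h; rewrite ltNge; apply/negP => h'.
      apply: seg; exists ((cy a - cy q) / (cy a - cy a')).
        rewrite /= in_itv /= ler_pdivlMr ?ler_pdivrMr; lra.
      apply: cxyP; rewrite P1_lerp; [|exact: cx_P1| |exact: cy_P1].
        by rewrite aq a'q; ring.
      field; lra.
    apply: seg; exists ((cy q - cy a) / (cy a' - cy a)).
      rewrite /= in_itv /= ler_pdivlMr ?ler_pdivrMr; lra.
    apply: cxyP; rewrite P1_lerp; [|exact: cx_P1| |exact: cy_P1].
      by rewrite aq a'q; ring.
    field; lra.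
  suff h x : crosses a a' x = crosses a a' q
      (+) (chi a x (+) chi a q) && (cy q < cy a')
      (+) (chi a' x (+) chi a' q) && (cy q < cy a').
    exact: filterS (fun x _ => h x) (@filterT _ (nbhs q) _).
  by rewrite /crosses !e !addbb /=; case: (_ && _).
- have n2 := chi_near a'q.
  (* Only the end [a] shares the abscissa of [q]: nearby, [chi a] may flip while [chi a'] is
     constant, and the sign of [line_eq], that of [cy q - cy a], decides whether the flip counts. *)
  have aa : cx a' != cx a by rewrite aq.
  have := line_eq_sign aa (na aq) (line_eq_left _ (esym aq)).
  rewrite subr_lt0 => n3.
  have h := nbhs_singleton n3.
  apply: filterS2 n2 n3 => x e2 e3; rewrite /crosses e2 e3 h.
  rewrite addbb /= addbF.
  by case: (chi a x); case: (chi a q); case: (chi a' q); case: (_ < _).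
- have n2 := chi_near aq.
  have aa : cx a' != cx a by rewrite a'q eq_sym.
  have := line_eq_sign aa (na' a'q) (line_eq_right _ (esym a'q)).
  rewrite subr_lt0 => n3.
  have h := nbhs_singleton n3.
  apply: filterS2 n2 n3 => x e2 e3; rewrite /crosses e2 e3 h.
  rewrite addbb /= addbF.
  by case: (chi a' x); case: (chi a q); case: (chi a' q); case: (_ < _).
- have n1 := chi_near aq; have n2 := chi_near a'q.
  apply: filterS3 n1 n2 (crosses_near_generic aq a'q seg) => x e1 e2 ->.
  by rewrite e1 e2 !addbb /= !addbF.
Qed.

Variables (m : nat) (p : 'I_m -> R * R).

Definition polygon : set (R * R) := \bigcup_i segment (p i) (p (ordS i)).

Definition parity q : bool :=
  \big[addb/false]_i crosses (p i) (p (ordS i)) q.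

Lemma parity_near q : ~ polygon q -> \forall x \near q, parity x = parity q.
Proof.
move=> nq.
have h i : \forall x \near nbhs q, crosses (p i) (p (ordS i)) x =
    crosses (p i) (p (ordS i)) q (+) vertex_corr (p i) q x
    (+) vertex_corr (p (ordS i)) q x.
  by apply: crosses_near => seg; apply: nq; exists i.
refine (@filterS _ (nbhs q) _ _ _ _ (@filter_forall _ _ _ (nbhs q) _ h)) => x hx.
rewrite /parity (eq_bigr _ (fun i _ => hx i)) !big_split /=.
have -> : \big[addb/false]_i vertex_corr (p (ordS i)) q x =
  \big[addb/false]_i vertex_corr (p i) q x.
  by rewrite [RHS](reindex_inj (@ordS_inj m)).
by rewrite -addbA addbb addbF.
Qed.

Lemma parity_connected (A : set (R * R)) q x : open A -> connected A ->
  A `&` polygon = set0 -> A q -> A x -> parity x = parity q.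
Proof.
move=> Ao Ac Ap Aq Ax.
have np y : A y -> ~ polygon y by move=> Ay py; have : set0 y by rewrite -Ap.
have op c : open [set y | A y /\ parity y = c].
  rewrite openE => y [Ay <-]; rewrite /interior.
  have n1 : nbhs y A by exact: open_nbhs_nbhs.
  by apply: filterS2 n1 (parity_near (np _ Ay)).
have : [set y | A y /\ parity y = parity q] = A.
  apply: Ac; first by exists q.
  - exists [set y | A y /\ parity y = parity q] => //.
    by apply/seteqP; split => y; [case|case].
  - exists (~` [set y | A y /\ parity y = ~~ parity q]).
      exact: open_closedC.
    apply/seteqP; split => y /=; first by move=> [Ay ->]; split=> // -[_]; case: parity.
    move=> [Ay h]; split=> //; apply: contrapT => h'; apply: h; split=> //.
    by move: h'; case: parity; case: parity.
by move=> /seteqP[_ /(_ x Ax)[]].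
Qed.

End parity.

Lemma segment_closed (R : realType) (a b : R * R) : closed (segment a b).
Proof.
apply: compact_closed; first exact: norm_hausdorff.
apply: continuous_compact; last exact: segment_compact.
exact/continuous_subspaceT/lerp_continuous.
Qed.

(** * Parity changes across a side of a simple polygon *)

Section jordan_polygon.
Variables (R : realType) (b : bool) (m : nat) (p : 'I_m -> R * R).
Implicit Types (x y q : R * R).
Hypothesis injp : injective_closed_polygon p.

Let sides_meet i j (s : R) : 0 < s < 1 -> j != i ->
  ~ segment (p j) (p (ordS j)) (lerp (p i) (p (ordS i)) s).
Proof.
move=> /andP[s0 s1] ji [t /=]; rewrite in_itv /= => /andP[t0 t1] e.
move: t1; rewrite le_eqVlt => /orP[/eqP t1|t1]; last first.
  have [] := @injp j i t s _ _ e; rewrite ?t0 ?t1 ?s1 ?(ltW s0)// => ij.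
  by rewrite ij eqxx in ji.
(* Injectivity concerns half-open sides, so the end of side [j] is read as the start of side
   [ordS j]; this yields [s = 0], which is excluded. *)
have [] := @injp (ordS j) i 0 s _ _ _; rewrite ?lexx ?ltr01 ?s1 ?(ltW s0)//.
  by rewrite lerp0 -e t1 lerp1.
by move=> _ s0'; rewrite -s0' ltxx in s0.
Qed.

Let ey : R * R := if b then (0, 1) else (1, 0).

Let cx_shift x (t : R) : cx b (x + t *: ey) = cx b x.
Proof. by rewrite /cx /ey; case: b; rewrite /= /GRing.scale /= mulr0 addr0. Qed.
Let cy_shift x (t : R) : cy b (x + t *: ey) = cy b x + t.
Proof. by rewrite /cy /ey; case: b; rewrite /= /GRing.scale /= mulr1. Qed.

(** Just above and just below [x], at the same abscissa, only the crossing with side [i] differs, so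
    the parities differ. If the domain were on both sides, the two points would lie in [Om], where
    parity is constant. *)
Lemma polygon_two_sided (Om : set (R * R)) i (s : R) :
  open Om -> connected Om -> Om `&` polygon p = set0 ->
  0 < s < 1 -> let x := lerp (p i) (p (ordS i)) s in
  cx b (p i) != cx b (p (ordS i)) -> (forall j, cx b (p j) != cx b x) ->
  ~ (\forall y \near x, (Om `|` polygon p) y).
Proof.
move=> Oo Oc OP s01 x ab gen nOP.
have n1 j : \forall y \near nbhs x, j != i ->
    crosses b (p j) (p (ordS j)) y = crosses b (p j) (p (ordS j)) x.
  have [->|ji] := eqVneq j i.
    by apply: (@filterS _ (nbhs x) _ setT); [|exact: filterT].
  have := crosses_near_generic (gen j) (gen (ordS j)) (sides_meet s01 ji).
  by apply: filterS.
have n2 j : \forall y \near nbhs x, j != i -> ~ segment (p j) (p (ordS j)) y.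
  have [->|ji] := eqVneq j i.
    by apply: (@filterS _ (nbhs x) _ setT); [|exact: filterT].
  have : open (~` segment (p j) (p (ordS j))).
    by apply: closed_openC; exact: segment_closed.
  rewrite openE => /(_ x (sides_meet s01 ji)); rewrite /interior.
  by apply: filterS.
have N : \forall y \near nbhs x, [/\ (Om `|` polygon p) y,
    forall j, j != i -> crosses b (p j) (p (ordS j)) y =
      crosses b (p j) (p (ordS j)) x &
    forall j, j != i -> ~ segment (p j) (p (ordS j)) y].
  by refine (@filterS3 _ (nbhs x) _ _ _ _ _ _ nOP
    (@filter_forall _ _ _ (nbhs x) _ n1)
    (@filter_forall _ _ _ (nbhs x) _ n2)) => y.
have sc : continuous (fun t : R => x + t *: ey).
  move=> t; apply: cvgD; first exact: cvg_cst.
  by apply: cvgZr_tmp; exact: cvg_id.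
have := sc 0; rewrite /continuous_at scale0r addr0 => /(_ _ N) /nbhs_ballP[e /= e0 H].
have H' t : `|t| < e -> [/\ (Om `|` polygon p) (x + t *: ey),
    forall j, j != i -> crosses b (p j) (p (ordS j)) (x + t *: ey) =
      crosses b (p j) (p (ordS j)) x &
    forall j, j != i -> ~ segment (p j) (p (ordS j)) (x + t *: ey)].
  by move=> te; apply: H; rewrite /ball /= sub0r normrN.
set dx := cx b (p (ordS i)) - cx b (p i).
have d0 : 0 < dx ^+ 2 by rewrite exprn_even_gt0//= subr_eq0 eq_sym.
have lx : line_eq b (p i) (p (ordS i)) x = 0.
  rewrite /x (P1_lerp _ _ _ (line_eq_P1 _ _ _)) line_eq_left//.
  by rewrite line_eq_right// !subrr; ring.
have lE t : line_eq b (p i) (p (ordS i)) (x + t *: ey) = dx ^+ 2 * t.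
  have -> : line_eq b (p i) (p (ordS i)) (x + t *: ey) =
    line_eq b (p i) (p (ordS i)) x + dx ^+ 2 * t.
    by rewrite /line_eq cx_shift cy_shift -/dx; ring.
  by rewrite lx add0r.
have HO t : t != 0 -> `|t| < e -> Om (x + t *: ey).
  move=> t0 /H'[[//|[j _ seg]] _ ns].
  have [ji|/ns //] := eqVneq j i; rewrite {}ji in seg.
  case: seg => r _ re.
  have := lE t; rewrite -re (P1_lerp _ _ _ (line_eq_P1 _ _ _)) line_eq_left//.
  rewrite line_eq_right// !subrr !mulr0 addr0 => /esym/eqP.
  by rewrite mulf_eq0 (negPf t0) orbF gt_eqF.
have e2 : 0 < e / 2 by rewrite divr_gt0.
have ee : e / 2 < e by rewrite ltr_pdivrMr// ltr_pMr// ltr1n.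
have nP : `|e / 2| < e by rewrite gtr0_norm.
have nN : `|- (e / 2)| < e by rewrite normrN gtr0_norm.
have tP : e / 2 != 0 by rewrite gt_eqF.
have tN : - (e / 2) != 0 by rewrite oppr_eq0.
have := parity_connected b Oo Oc OP (HO _ tP nP) (HO _ tN nN).
have [_ cP _] := H' _ nP; have [_ cN _] := H' _ nN.
set S := \big[addb/false]_(j | j != i) crosses b (p j) (p (ordS j)) x.
have sP : \big[addb/false]_(j | j != i) crosses b (p j) (p (ordS j))
    (x + (e / 2) *: ey) = S by exact: eq_bigr.
have sN : \big[addb/false]_(j | j != i) crosses b (p j) (p (ordS j))
    (x + - (e / 2) *: ey) = S by exact: eq_bigr.
rewrite /parity (bigD1 i)//= [in RHS](bigD1 i)//= sP sN.
have -> : crosses b (p i) (p (ordS i)) (x + (e / 2) *: ey) = false.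
  by rewrite /crosses lE ltNge mulr_ge0 ?ltW// andbF.
have -> : crosses b (p i) (p (ordS i)) (x + - (e / 2) *: ey) = true.
  rewrite /crosses lE mulrN oppr_lt0 mulr_gt0// andbT /chi cx_shift.
  have : cx b x = (1 - s) * cx b (p i) + s * cx b (p (ordS i)).
    by rewrite P1_lerp//; exact: cx_P1.
  case/andP : s01 => s0 s1.
  move: ab; rewrite neq_lt => /orP[] ab ->; case: leP; case: leP => //= h1 h2; nra.
by case: (S).
Qed.

End jordan_polygon.

(** * Mesh edges and the boundary *)

Lemma bdry_openE (R : realType) (A : set (R * R)) : open A ->
  bdry A = closure A `\` A.
Proof. by move=> /interior_id Ao; rewrite /bdry Ao. Qed.

(** If the segment avoids the boundary, the parameters that land in [A] are those that land in
    [closure A]: a clopen subset of [0, 1] containing 0, hence also 1. *)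
Lemma segment_meets_bdry (R : realType) (A : set (R * R)) (q s : R * R) :
  open A -> closure A q -> ~ closure A s ->
  exists2 t : R, 0 <= t <= 1 & bdry A (lerp q s t).
Proof.
move=> Ao Aq As; apply: contrapT => nex.
have nb t : 0 <= t <= 1 -> closure A (lerp q s t) -> A (lerp q s t).
  move=> t01 clA; apply: contrapT => nA; apply: nex; exists t => //.
  by rewrite bdry_openE.
have lc := @lerp_continuous R q s.
have : `[0, 1]%classic `&` (lerp q s @^-1` A) = `[0, 1]%classic.
  apply: (@segment_connected R 0 1).
  - exists 0; split; first by rewrite /= in_itv /= lexx ler01.
    by apply: nb; rewrite ?lexx ?ler01 ?lerp0.
  - exists (lerp q s @^-1` A) => //.
    by apply: open_comp => // x _; exact: lc.
  - exists (lerp q s @^-1` closure A).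
      by apply: preimage_closed; [move=> x _; exact: lc|exact: closed_closure].
    apply/seteqP; split=> t /= [t01 h]; split=> //.
      exact: subset_closure.
    by apply: nb h; move: t01; rewrite in_itv.
move=> /seteqP[_ /(_ 1)]; rewrite /= in_itv /= lexx ler01 lerp1 => /(_ isT)[_].
by move=> /subset_closure.
Qed.

Section mesh_boundary.
Variables (R : realType) (Omega : set (R * R)) (M : mesh R).
Implicit Types (K L : 'I_(nelt M)) (i j : 'I_3) (x y a b : R * R).
Hypothesis hM : triangulation M Omega.
Hypothesis Oo : open Omega.

Lemma triangulation_orient K : orient K != 0.
Proof. by case: hM => h _ _; apply/eqP; exact: h. Qed.
Let nd := triangulation_orient.

Lemma closure_elt x : closure Omega x <-> exists K, elt K x.
Proof.
case: hM => _ -> _; split; first by case=> K _ h; exists K.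
by case=> K h; exists K.
Qed.

Lemma elt_meet K L x : K <> L -> elt K x -> elt L x ->
  (exists i j, [/\ vtx K i = vtx L j, elt K `&` elt L = [set vtx K i] & x = vtx K i]) \/
  (exists i j, [/\ edge K i = edge L j, elt K `&` elt L = edge K i & edge K i x]).
Proof.
case: hM => _ _ /[apply] h Kx Lx; case: h.
- by move=> h; have : set0 x by rewrite -h.
- move=> [i [j [e h]]]; left; exists i, j; split=> //.
  by have : [set vtx K i] x by rewrite -h.
- by move=> [i [j [e h]]]; right; exists i, j; split=> //; rewrite -h.
Qed.

Definition relint_edge K i x :=
  [/\ bary K i x = 0, 0 < bary K (i + 1) x & 0 < bary K (i - 1) x].

Lemma relint_edge_edge K i x : relint_edge K i x -> edge K i x.
Proof.
move=> [x0 x1 x2]; apply/(edgeP nd); split=> //; apply/(eltP nd) => k.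
by have [->|->|->] := ord3_cyclic i k; rewrite ?x0// ltW.
Qed.

Lemma relint_edge_lerp K i x :
  relint_edge K i x <->
  exists2 s : R, 0 < s < 1 & x = lerp (vtx K (i + 1)) (vtx K (i - 1)) s.
Proof.
have [n1 n2 n3] := ord3_neq i.
have E k s : bary K k (lerp (vtx K (i + 1)) (vtx K (i - 1)) s) =
      (1 - s) * (k == i + 1)%:R + s * (k == i - 1)%:R.
  by rewrite P1_lerp ?bary_vtx//; exact: bary_P1.
split.
  move=> h; have [s _ sE] := relint_edge_edge h; exists s => //.
  case: h => _; rewrite -sE !E !eqxx (negPf n3) (eq_sym (i - 1)) (negPf n3).
  by rewrite !mulr0 !mulr1 addr0 add0r subr_gt0 => -> ->.
move=> [s /andP[s0 s1] ->]; rewrite /relint_edge !E !eqxx (negPf n3).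
rewrite !(eq_sym i) (negPf n1) (negPf n2) (eq_sym (i - 1)) (negPf n3).
by rewrite !mulr0 !mulr1 !addr0 add0r subr_gt0.
Qed.

Lemma relint_edge_eq K L i j x : edge K i = edge L j ->
  relint_edge K i x -> relint_edge L j x.
Proof.
move=> /segment_ends e /relint_edge_lerp[s /andP[s0 s1] sE].
apply/relint_edge_lerp; case: e => -[e1 e2].
  by exists s; rewrite ?s0 ?s1// -e1 -e2.
exists (1 - s); first by rewrite subr_gt0 s1 ltrBlDr ltrDl.
by rewrite -e1 -e2 sE !lerpE addrC; congr (_ *: _ + _); ring.
Qed.

(** Coordinate [j] of [L] vanishes on the common edge, so it is a multiple [kappa] of coordinate [i]
    of [K]. With [kappa] nonnegative, points just inside [K] would also be in [L], although the
    elements meet only along the edge; hence [kappa < 0] and they lie on opposite sides. *)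
Lemma shared_edge_nbhs K L i j y : edge K i = edge L j ->
  elt K `&` elt L = edge K i -> relint_edge K i y ->
  \forall x \near y, (elt K `|` elt L) x.
Proof.
move=> e KL yK; have yL := relint_edge_eq e yK.
have [yK0 yK1 yK2] := yK; have [yL0 yL1 yL2] := yL.
have cK k := @bary_continuous R M nd K k y.
have cL k := @bary_continuous R M nd L k y.
have nK1 := near_gt (cK _) yK1; have nK2 := near_gt (cK _) yK2.
have nL1 := near_gt (cL _) yL1; have nL2 := near_gt (cL _) yL2.
set kappa := bary L j (vtx K i).
have lamE x : bary L j x = kappa * bary K i x.
  have := P1_bary nd K x (bary_P1 nd L j).
  rewrite (sum_ord3_cyclic _ i).
  have z k : edge K i (vtx K k) -> bary L j (vtx K k) = 0.
    by rewrite e => /(edgeP nd)[].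
  have [/z -> /z ->] := edgeS K i.
  by rewrite !mulr0 !addr0 mulrC.
have nL : \forall x \near nbhs y, [/\ 0 < bary K (i + 1) x, 0 < bary K (i - 1) x,
    0 < bary L (j + 1) x & 0 < bary L (j - 1) x].
  by near=> x; split; near: x.
have inK x : 0 < bary K (i + 1) x -> 0 < bary K (i - 1) x -> 0 <= bary K i x ->
    elt K x.
  move=> h1 h2 h0; apply/(eltP nd) => k.
  by have [->|->|->] := ord3_cyclic i k => //; exact: ltW.
have inL x : 0 < bary L (j + 1) x -> 0 < bary L (j - 1) x -> 0 <= bary L j x ->
    elt L x.
  move=> h1 h2 h0; apply/(eltP nd) => k.
  by have [->|->|->] := ord3_cyclic j k => //; exact: ltW.
have k0 : kappa < 0.
  rewrite ltNge; apply/negP => k0.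
  have := @lerp_continuous R y (vtx K i) 0; rewrite /continuous_at lerp0.
  move=> /(_ _ nL) /nbhs_ballP[r /= r0 H].
  have {H} /= := H _ (ball0_half r0).1.
  set x := lerp _ _ _ => -[x1 x2 x3 x4].
  have xi : bary K i x = r / 2.
    rewrite P1_lerp; last exact: bary_P1.
    by rewrite yK0 bary_vtx// eqxx mulr0 add0r mulr1.
  have xK : elt K x by apply: inK => //; rewrite xi divr_ge0// ltW.
  have xL : elt L x.
    by apply: inL => //; rewrite lamE xi mulr_ge0// divr_ge0// ltW.
  have : edge K i x by rewrite -KL.
  move=> /(edgeP nd)[_]; rewrite xi => /eqP.
  by rewrite gt_eqF// divr_gt0.
refine (@filterS _ (nbhs y) _ _ _ _ nL) => x [x1 x2 x3 x4].
have [h|h] := leP 0 (bary K i x); first by left; exact: inK.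
by right; apply: inL; rewrite ?lamE// nmulr_rge0// ltW.
Unshelve. all: by end_near.
Qed.

Lemma elt_closure K : elt K `<=` closure Omega.
Proof. by move=> x xK; apply/closure_elt; exists K. Qed.

(** Moving a point of the edge in [Omega] slightly towards the midpoint makes it relatively
    interior. Its neighbourhood is covered by elements, but not by [K] alone, which is left by
    moving away from vertex [i]. A second element through this point can only meet [K] along edge
    [i]. *)
Lemma inner_edge_shared K i : ~ edge K i `<=` bdry Omega ->
  exists L j, [/\ K <> L, edge K i = edge L j & elt K `&` elt L = edge K i].
Proof.
move=> /existsNP[x /not_implyP[xe xO]].
have {}xO : Omega x.
  apply: contrapT => nO; apply: xO; rewrite bdry_openE//; split=> //.
  by apply: (@elt_closure K); exact: edge_elt xe.
have [y yO yr] : exists2 y, Omega y & relint_edge K i y.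
  set m := lerp (vtx K (i + 1)) (vtx K (i - 1)) 2^-1.
  have mr : relint_edge K i m.
    apply/relint_edge_lerp; exists 2^-1 => //.
    by rewrite invr_gt0 ltr0n invf_lt1 ?ltr0n ?ltr1n.
  have := @lerp_continuous R x m 0; rewrite /continuous_at lerp0.
  move=> /(_ _ (open_nbhs_nbhs (conj Oo xO))) /nbhs_ballP[r /= r0 H].
  set t := Num.min (r / 2) 2^-1.
  have t0 : 0 < t by rewrite lt_min divr_gt0//= invr_gt0.
  have t1 : t <= 1 by rewrite ge_min invf_le1 ?ler1n ?orbT.
  exists (lerp x m t).
    apply: H; rewrite /ball /= sub0r normrN gtr0_norm// gt_min.
    by rewrite ltr_pdivrMr// ltr_pMr// ltr1n.
  move: xe => /(edgeP nd)[/(eltP nd) xK x0]; case: mr => m0 m1 m2.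
  have pos k : 0 < bary K k m -> 0 < bary K k (lerp x m t).
    move=> mk; rewrite P1_lerp; last exact: bary_P1.
    by apply: ltr_wpDl; [rewrite mulr_ge0// subr_ge0|rewrite mulr_gt0].
  split; [|exact: pos|exact: pos].
  by rewrite P1_lerp ?x0 ?m0 ?mulr0 ?addr0//; exact: bary_P1.
have [L KL yL] : exists2 L, K <> L & elt L y.
  apply: contrapT => nL.
  have n1 L : \forall z \near nbhs y, K <> L -> ~ elt L z.
    have [<-|/eqP KL] := eqVneq K L.
      by apply: (@filterS _ (nbhs y) _ setT); [|exact: filterT].
    have : open (~` elt L) by apply: closed_openC; exact: elt_closed.
    rewrite openE => /(_ y); rewrite /interior => h.
    have : nbhs y (~` elt L) by apply: h => yL; apply: nL; exists L.
    by apply: filterS.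
  have n2 : \forall z \near nbhs y, elt K z.
    refine (@filterS2 _ (nbhs y) _ _ _ _ _ (open_nbhs_nbhs (conj Oo yO))
      (@filter_forall _ _ _ (nbhs y) _ n1)) => z /subset_closure.
    move=> /closure_elt[L zL] h.
    by have [->//|/eqP/h] := eqVneq K L.
  have := @lerp_continuous R y (vtx K i) 0; rewrite /continuous_at lerp0.
  move=> /(_ _ n2) /nbhs_ballP[r /= r0 H].
  have {H} /= := H _ (ball0_half r0).2.
  move=> /(eltP nd)/(_ i); case: yr => y0 _ _.
  rewrite P1_lerp; last exact: bary_P1.
  by rewrite bary_vtx// eqxx y0 mulr0 add0r mulr1 oppr_ge0 leNgt divr_gt0.
have [y0 y1 y2] := yr.
have yK := edge_elt nd (relint_edge_edge yr).
case: (elt_meet KL yK yL) => -[i' [j [e h]]].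
  move=> yE; move: y0 y1 y2; rewrite yE !bary_vtx//.
  have [n1 n2 n3] := ord3_neq i.
  have [->|->|->] := ord3_cyclic i i'; 
    rewrite ?eqxx ?(negPf n1) ?(negPf n2) ?(negPf n3) ?ltxx //.
  by move=> _ _; rewrite eq_sym (negPf n3) ltxx.
move=> /(edgeP nd)[_ yi'].
suff ii : i' = i by exists L, j; rewrite -ii.
by have [|E|E] := ord3_cyclic i i' => //; rewrite E in yi';
  rewrite yi' ltxx in y1 y2.
Qed.

Lemma relint_edge_frontier K i y : relint_edge K i y -> ~ (closure Omega)° y ->
  edge K i `<=` bdry Omega.
Proof.
move=> yr ny; apply: contrapT => /inner_edge_shared[L [j [KL e h]]].
apply: ny; rewrite /interior.
refine (@filterS _ (nbhs y) _ _ _ _ (shared_edge_nbhs e h yr)) => z.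
by case; exact: elt_closure.
Qed.

Lemma frontier_edge y : closure Omega y -> ~ (closure Omega)° y ->
  (forall K i, y <> vtx K i) ->
  exists K i, edge K i y /\ edge K i `<=` bdry Omega.
Proof.
move=> /closure_elt[K yK] ny nv.
have [i yi] : exists i, bary K i y = 0.
  apply: contrapT => h; apply: ny.
  apply: (@interiorS _ (elt K)); first exact: elt_closure.
  apply/(interior_eltP nd) => i; rewrite lt_neqAle (eltP nd K y).1// andbT eq_sym.
  by apply/eqP => yi; apply: h; exists i.
have yv k : bary K k y = 1 -> y = vtx K k.
  move=> yk; rewrite [LHS](bary_rec nd K) (sum_ord3_cyclic _ k) yk scale1r.
  have := bary_sum1 nd K y; rewrite (sum_ord3_cyclic _ k) yk => s1.
  have h1 := (eltP nd K y).1 yK (k + 1); have h2 := (eltP nd K y).1 yK (k - 1).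
  have -> : bary K (k + 1) y = 0 by lra.
  have -> : bary K (k - 1) y = 0 by lra.
  by rewrite !scale0r !addr0.
have s1 := bary_sum1 nd K y; rewrite (sum_ord3_cyclic _ i) yi add0r in s1.
have h1 := (eltP nd K y).1 yK (i + 1); have h2 := (eltP nd K y).1 yK (i - 1).
have yr : relint_edge K i y.
  split=> //.
    rewrite lt_neqAle h1 andbT eq_sym; apply/eqP => h.
    by apply: (nv K (i - 1)); apply: yv; lra.
  rewrite lt_neqAle h2 andbT eq_sym; apply/eqP => h.
  by apply: (nv K (i + 1)); apply: yv; lra.
by exists K, i; split; [exact: relint_edge_edge|exact: relint_edge_frontier yr ny].
Qed.

End mesh_boundary.

(** * The boundary polygon is covered by the mesh edges that it contains *)

Section boundary_edges.
Variables (R : realType) (Omega : set (R * R)) (M : mesh R).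
Hypothesis hM : triangulation M Omega.
Hypothesis hO : polygonal_domain Omega.
Let nd := triangulation_orient hM.

(** If [x] is off the closed union [G] of the boundary mesh edges, so is a point [y] slightly
    further along its side of the polygon, chosen in general position. By [polygon_two_sided], [y]
    is not interior to [closure Omega], so [frontier_edge] puts it in [G] after all. *)
Lemma bdry_edge (x : R * R) : bdry Omega x ->
  exists (K : 'I_(nelt M)) i, edge K i x /\ edge K i `<=` bdry Omega.
Proof.
case: hO => Oo Oc _ _ [m [p [injp bE]]].
pose G := \bigcup_(e in [set e : 'I_(nelt M) * 'I_3 | edge e.1 e.2 `<=` bdry Omega])
  edge e.1 e.2.
have Gc : closed G.
  apply: closed_bigcup; first exact: finite_finset.
  by move=> e _; exact: edge_closed.
have GP y : G y -> exists (K : 'I_(nelt M)) i,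
    edge K i y /\ edge K i `<=` bdry Omega.
  by move=> [[K i] /= h1 h2]; exists K, i.
move=> xb; apply: GP; apply: contrapT => nG.
(* The parameter is kept below 1, passing to the next side at a vertex, to leave room for moving
   forward. *)
have [i [s [/andP[s0 s1] xE]]] :
    exists i s, 0 <= s < 1 /\ x = lerp (p i) (p (ordS i)) s.
  move: (xb); rewrite bE => -[i _ [s /=]]; rewrite in_itv /= => /andP[s0 s1] sE.
  move: s1; rewrite le_eqVlt => /orP[/eqP s1|s1].
    exists (ordS i), 0; rewrite lexx ltr01; split=> //.
    by rewrite lerp0 -sE s1 lerp1.
  by exists i, s; rewrite s0 s1.
(* By injectivity the side is not reduced to a point, so one of the two coordinates varies along it
   and can serve as abscissa. *)
have [b ab] : exists b, cx b (p i) != cx b (p (ordS i)).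
  apply: contrapT => nb.
  have e b : cx b (p i) = cx b (p (ordS i)).
    by apply/eqP/negPn/negP => h; apply: nb; exists b.
  have pp : p i = p (ordS i) by apply: pairP; [exact: e true|exact: e false].
  have [] := @injp i i 0 2^-1 _ _ _.
  - by rewrite lexx ltr01.
  - by rewrite invr_ge0 ler0n invf_lt1 ?ltr0n ?ltr1n.
  - by rewrite -pp /lerp subrr !scaler0.
  by move=> _ /esym/eqP; rewrite invr_eq0 pnatr_eq0.
have Gn : \forall t \near s^'+, ~ G (lerp (p i) (p (ordS i)) t).
  have : nbhs x (~` G) by apply: open_nbhs_nbhs; split=> //; exact: closed_openC.
  rewrite xE => h.
  have h' : nbhs s (lerp (p i) (p (ordS i)) @^-1` (~` G)).
    exact: (@lerp_continuous R (p i) (p (ordS i)) s _ h).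
  exact: (@filterS _ (nbhs s) _ _ _ (fun t ht _ => ht) h').
have gen c : \forall t \near s^'+, c != cx b (lerp (p i) (p (ordS i)) t).
  (* The only parameter at which the line of the side has abscissa [c]. *)
  set t0 := (c - cx b (p i)) / (cx b (p (ordS i)) - cx b (p i)).
  have h t : t != t0 -> c != cx b (lerp (p i) (p (ordS i)) t).
    apply: contraNneq => e; rewrite /t0 e P1_lerp; last exact: cx_P1.
    by apply/eqP; field; rewrite subr_eq0 eq_sym.
  have [st|ts] := ltP s t0.
    near=> t; apply: h; rewrite lt_eqF//; near: t; exact: nbhs_right_lt.
  near=> t; apply: h; rewrite gt_eqF// (le_lt_trans ts)//; near: t.
have g1 := @filter_forall _ _ _ s^'+ _ (fun j => gen (cx b (p j))).
have g2 := @filter_forall _ _ _ s^'+ _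
  (fun e : 'I_(nelt M) * 'I_3 => gen (cx b (vtx e.1 e.2))).
have : exists t, [/\ s < t < 1, ~ G (lerp (p i) (p (ordS i)) t),
    forall j, cx b (p j) != cx b (lerp (p i) (p (ordS i)) t) &
    forall e : 'I_(nelt M) * 'I_3,
      cx b (vtx e.1 e.2) != cx b (lerp (p i) (p (ordS i)) t)].
  have g0 : \forall t \near s^'+, s < t < 1.
    apply: filterS2 (nbhs_right_gt s) (nbhs_right_lt s1) => t -> ->.
    by [].
  apply: (@filter_ex _ s^'+).
  refine (@filterS3 _ s^'+ _ _ _ _ _ _ (filterI g0 Gn) (g1 _) (g2 _)).
  by move=> t [].
move=> [t [/andP[st t1] nGt h1 h2]]; apply: nGt.
set y := lerp _ _ _ in h1 h2 *.
have yb : bdry Omega y.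
  rewrite bE; exists i => //; exists t => //=.
  by rewrite in_itv /= (le_trans s0 (ltW st)) ltW.
have OP : Omega `&` polygon p = set0.
  apply/seteqP; split=> // z [Oz]; rewrite /polygon -bE.
  by rewrite bdry_openE// => -[_].
have ny : ~ (closure Omega)° y.
  have t01 : 0 < t < 1 by rewrite (le_lt_trans s0 st).
  move=> cy; apply: (polygon_two_sided injp Oo Oc OP t01 ab h1).
  apply: filterS cy => z cz.
  have [Oz|nOz] := pselect (Omega z); [by left|right].
  by rewrite /polygon -bE bdry_openE.
have [K [k [yK kb]]] : exists (K : 'I_(nelt M)) k,
    edge K k y /\ edge K k `<=` bdry Omega.
  apply: frontier_edge => //; first by case: yb.
  move=> K k yv; have := h2 (K, k).
  by rewrite /= yv eqxx.
by exists (K, k).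
Unshelve. all: by end_near.
Qed.

End boundary_edges.

(** * Cocycles and potentials in the plane *)

Section cocycle.
Variable R : realType.
Implicit Types (x y p q s : R * R) (r d : R).

Lemma small_subdivision (l d : R) : 0 < d -> exists n : nat, l / n.+1%:R < d.
Proof.
move=> d0; exists (Num.truncn (l / d)).
by rewrite ltr_pdivrMr ?ltr0n// mulrC -ltr_pdivrMr// truncnS_gt.
Qed.

Lemma ball_prodE x r y : ball x r y <-> `|x - y| < r.
Proof. by rewrite -ball_normE. Qed.

Lemma ball_lerp p q s r t : 0 <= t <= 1 -> ball p r q -> ball p r s ->
  ball p r (lerp q s t).
Proof.
move=> /andP[t0 t1]; rewrite !ball_prodE => hq hs.
have -> : p - lerp q s t = (1 - t) *: (p - q) + t *: (p - s).
  by apply: pairP; rewrite /lerp /= /GRing.scale /=; ring.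
rewrite (le_lt_trans (ler_normD _ _))// !normrZ ger0_norm ?subr_ge0//.
rewrite ger0_norm//; move: t0; rewrite le_eqVlt => /orP[/eqP <-|t0]; first nra.
have h1 : (1 - t) * `|p - q| <= (1 - t) * r.
  by rewrite ler_wpM2l ?subr_ge0// ltW.
have h2 : t * `|p - s| < t * r by rewrite ltr_pM2l.
lra.
Qed.

(* Along the chain [k/n x], the rungs [c (k/n x) (k/n y)] telescope. *)
Lemma cocycle_potential (c : R * R -> R * R -> R) (r rho : R) : 0 < r ->
  (forall p q s, `|p| <= rho -> `|q| <= rho -> `|s| <= rho ->
     `|p - q| < r -> `|q - s| < r -> `|p - s| < r -> c p q + c q s = c p s) ->
  exists u : R * R -> R, exists2 d, 0 < d &
    forall x y, `|x| <= rho -> `|y| <= rho -> `|x - y| < d -> u y - u x = c x y.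
Proof.
move=> r0 H; have r2 : 0 < r / 2 by rewrite divr_gt0.
have [n hn] := small_subdivision rho r2.
have n0 : 0 < n.+1%:R :> R by rewrite ltr0n.
pose f k : R := k%:R / n.+1%:R.
pose u x := \sum_(0 <= k < n.+1) c (f k *: x) (f k.+1 *: x).
exists u; exists (r / 2) => // x y xr yr xy.
have f01 k : (k <= n.+1)%N -> 0 <= f k <= 1.
  move=> kn; rewrite /f divr_ge0 ?ler0n//=.
  by rewrite ler_pdivrMr// mul1r ler_nat.
have fS k z : `|f k *: z - f k.+1 *: z| = `|z| / n.+1%:R.
  rewrite -scalerBl normrZ mulrC; congr (_ * _).
  rewrite /f -[k.+1%:R]natr1 -mulrBl opprD addrA subrr sub0r mulN1r normrN.
  by rewrite gtr0_norm// invr_gt0.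
have fr k z : (k <= n.+1)%N -> `|z| <= rho -> `|f k *: z| <= rho.
  move=> /f01/andP[h0 h1] zr; rewrite normrZ ger0_norm//.
  by rewrite (le_trans _ zr)// ler_piMl.
have fxy k : (k <= n.+1)%N -> `|f k *: x - f k *: y| < r / 2.
  move=> /f01/andP[h0 h1]; rewrite -scalerBr normrZ ger0_norm//.
  by rewrite (le_lt_trans _ xy)// ler_piMl.
have fSr k z : `|z| <= rho -> `|f k *: z - f k.+1 *: z| < r / 2.
  by move=> zr; rewrite fS (le_lt_trans _ hn)// ler_pM2r// invr_gt0.
have rr : r / 2 < r by rewrite ltr_pdivrMr// ltr_pMr// ltr1n.
have -> : u y - u x = \sum_(0 <= k < n.+1)
    (c (f k.+1 *: x) (f k.+1 *: y) - c (f k *: x) (f k *: y)).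
  rewrite /u -sumrB; apply: eq_big_nat => k /andP[_ kn].
  have kn' := ltnW kn.
  (* Both ways around the small quadrilateral are compared with its diagonal from [f k *: x] to
     [f k.+1 *: y]. *)
  have d : `|f k *: x - f k.+1 *: y| < r.
    rewrite (_ : _ - _ = (f k *: x - f k *: y) + (f k *: y - f k.+1 *: y)).
      rewrite (le_lt_trans (ler_normD _ _))// [ltRHS]splitr.
      by rewrite ltrD ?fxy ?fSr.
    by rewrite addrA subrK.
  have h1 : c (f k *: x) (f k *: y) + c (f k *: y) (f k.+1 *: y)
      = c (f k *: x) (f k.+1 *: y).
    by apply: H; rewrite ?fr// (lt_trans _ rr)// ?fxy ?fSr.
  have h2 : c (f k *: x) (f k.+1 *: x) + c (f k.+1 *: x) (f k.+1 *: y)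
      = c (f k *: x) (f k.+1 *: y).
    by apply: H; rewrite ?fr// (lt_trans _ rr)// ?fxy ?fSr.
  by rewrite -h1 in h2; lra.
rewrite telescope_sumr// /f divff ?gt_eqF// !scale1r mul0r !scale0r.
have rho0 : 0 <= rho := le_trans (normr_ge0 x) xr.
(* Telescoping leaves [c x y - c 0 0], and the cocycle identity at the origin forces [c 0 0 = 0]. *)
have := H 0 0 0; rewrite normr0 subrr normr0 => /(_ rho0 rho0 rho0 r0 r0 r0).
lra.
Qed.

(** Cutting the segment into steps shorter than [d] and telescoping turns a local increment formula
    into a global one. *)
Lemma segment_chain (u : R * R -> R) (l d : R) x y : 0 < d ->
  (forall s t : R, 0 <= s <= 1 -> 0 <= t <= 1 ->
     `|lerp x y s - lerp x y t| < d ->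
     u (lerp x y t) - u (lerp x y s) = (t - s) * l) ->
  u y - u x = l.
Proof.
move=> d0 H; have [n hn] := small_subdivision `|y - x| d0.
have n0 : 0 < n.+1%:R :> R by rewrite ltr0n.
pose f k : R := k%:R / n.+1%:R.
have f01 k : (k <= n.+1)%N -> 0 <= f k <= 1.
  move=> kn; rewrite /f divr_ge0 ?ler0n//=.
  by rewrite ler_pdivrMr// mul1r ler_nat.
have f1 : f n.+1 = 1 by rewrite /f divff// gt_eqF.
have f0 : f 0%N = 0 by rewrite /f mul0r.
have -> : u y - u x =
    \sum_(0 <= k < n.+1) (u (lerp x y (f k.+1)) - u (lerp x y (f k))).
  by rewrite (telescope_sumr (fun k => u (lerp x y (f k))))// f1 f0 lerp1 lerp0.
have -> : l = \sum_(0 <= k < n.+1) (f k.+1 * l - f k * l).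
  by rewrite (telescope_sumr (fun k => f k * l))// f1 f0 mul1r mul0r subr0.
apply: eq_big_nat => k /andP[_ kn].
rewrite H ?f01//; [ring|exact: ltnW|].
rewrite lerpB normrZ (_ : f k - f k.+1 = - n.+1%:R^-1).
  by rewrite normrN gtr0_norm ?invr_gt0// mulrC.
by rewrite /f -[k.+1%:R]natr1; field; rewrite gt_eqF.
Qed.

End cocycle.

(** * Global potential of a field that is constant on each element *)

Section mesh_potential.
Variables (R : realType) (Omega : set (R * R)) (M : mesh R).
Implicit Types (K L : 'I_(nelt M)) (i j : 'I_3) (x y a b p q : R * R) (r : R).
Hypothesis hM : triangulation M Omega.
Hypothesis hO : polygonal_domain Omega.
Let nd := triangulation_orient hM.
Let Oo : open Omega. Proof. by case: hO. Qed.

(** A common base point for the ball: all elements that reach into it contain [a], so that the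
    functions [dot (w K) (x - a)] fit together there. *)
Definition same_faces p r a :=
  (forall K x, ball p r x -> elt K x -> elt K a) /\
  (forall K i x, ball p r x -> edge K i x -> edge K i a).

Lemma near_avoid (A : set (R * R)) p : closed A ->
  \forall x \near p, A x -> A p.
Proof.
move=> Ac; have [Ap|nAp] := pselect (A p).
  exact: (@filterS _ (nbhs p) _ setT _ (fun _ _ _ => Ap) filterT).
have : nbhs p (~` A) by apply: open_nbhs_nbhs; split=> //; exact: closed_openC.
by apply: filterS => x nAx /nAx.
Qed.

Lemma same_faces_self p : exists2 e, 0 < e & same_faces p e p.
Proof.
have n1 : \forall x \near nbhs p, forall K, elt K x -> elt K p.
  apply: (@filter_forall _ _ _ (nbhs p)) => K.
  by apply: near_avoid; exact: elt_closed.
have n2 : \forall x \near nbhs p, forall e : 'I_(nelt M) * 'I_3,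
    edge e.1 e.2 x -> edge e.1 e.2 p.
  apply: (@filter_forall _ _ _ (nbhs p)) => e.
  by apply: near_avoid; exact: edge_closed.
have /nbhs_ballP[e /= e0 H] := @filterI _ (nbhs p) (nbhs_filter p) _ _ n1 n2.
exists e => //; split=> [K x /H[h _]|K i x /H[_ h]]; first exact: h.
exact: (h (K, i)).
Qed.

Lemma ball_half p q r e x : ball p (e / 2) q -> r < e / 2 -> ball q r x ->
  ball p e x.
Proof.
move=> /ball_prodE pq re /ball_prodE qx; apply/ball_prodE.
have -> : p - x = (p - q) + (q - x) by rewrite addrA subrK.
rewrite (le_lt_trans (ler_normD _ _))//; lra.
Qed.

(** Lebesgue number argument: if [p] is a base point for the ball of radius [e] around itself, it
    also serves all balls of radius less than [e / 2] with centre within [e / 2] of [p]. Compactness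
    of the square makes the radius uniform. *)
Lemma same_faces_uniform (rho : R) : exists2 r, 0 < r &
  forall p, `|p| <= rho -> exists a, same_faces p r a.
Proof.
pose B := (`[- rho, rho]%classic `*` `[- rho, rho]%classic) : set (R * R).
have Bc : compact B by apply: compact_setX; exact: segment_compact.
have H p : B p -> \forall q \near p & r \near (0 : R)^'+,
    exists a, same_faces q r a.
  move=> _; have [e e0 [h1 h2]] := same_faces_self p.
  have e2 : 0 < e / 2 by rewrite divr_gt0.
  exists (ball p (e / 2), [set r | r < e / 2]).
    by split; [exact: nbhsx_ballx|exact: nbhs_right_lt].
  move=> [q r] /= [pq re]; exists p; split.
    by move=> K x qx; apply: h1; exact: ball_half qx.
  by move=> K i x qx; apply: h2; exact: ball_half qx.
have H' := (compact_near_coveringP B).1 Bc R (0 : R)^'+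
  (fun r q => exists a, same_faces q r a) _ H.
have [] := filter_ex (filterI (nbhs_right_gt (0 : R)) (H' _)).
move=> r [r0 Br]; exists r => // p pr; apply: Br.
move: pr; rewrite prod_normE ge_max => /andP[h1 h2].
by split; rewrite /= in_itv /= -ler_norml.
Qed.

Lemma bounded_closure : exists rho : R,
  forall x, closure Omega x -> `|x| <= rho.
Proof.
case: hO => _ _ _ [rho0 [_ hrho]] _.
exists (rho0 + 1) => x.
have cl : closed [set x : R * R | 0 <= rho0 + 1 - `|x|].
  apply: closed_ge0 => y; apply: cvgB; first exact: cvg_cst.
  exact: norm_continuous.
have sub : Omega `<=` [set x : R * R | 0 <= rho0 + 1 - `|x|].
  by move=> y Oy /=; rewrite subr_ge0; apply: hrho; rewrite ?ltrDl.
by move=> /(closure_subset sub); rewrite -(closure_id _).1//= subr_ge0.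
Qed.

Variable w : 'I_(nelt M) -> R * R.
Hypothesis w_shared : forall K L i j, K <> L -> edge K i = edge L j ->
  dot (w K) (vtx K (i - 1) - vtx K (i + 1)) =
  dot (w L) (vtx K (i - 1) - vtx K (i + 1)).
Hypothesis w_bdry : forall K i, edge K i `<=` bdry Omega ->
  dot (w K) (vtx K (i - 1) - vtx K (i + 1)) = 0.

Lemma edge_diff K i a b : edge K i a -> edge K i b ->
  exists t : R, b - a = t *: (vtx K (i - 1) - vtx K (i + 1)).
Proof. by move=> [s _ <-] [t _ <-]; exists (t - s); rewrite lerpB. Qed.

(** Distinct elements meet in a vertex, where [b = a], or in an edge, along which [w_shared] equates
    the tangential components. *)
Lemma w_agree K L a b : elt K a -> elt K b -> elt L a -> elt L b ->
  dot (w K) (b - a) = dot (w L) (b - a).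
Proof.
move=> Ka Kb La Lb; have [->//|/eqP KL] := eqVneq K L.
case: (elt_meet hM KL Ka La) => -[i [j [e h ha]]].
  have : (elt K `&` elt L) b by [].
  by rewrite h ha => ->; rewrite subrr !dot0r.
have hb : edge K i b by rewrite -h.
have [t ->] := edge_diff ha hb.
by rewrite !dotZr (w_shared KL e).
Qed.

(** The choice of the element is immaterial by [w_agree]; the default 0 is the extension by zero
    outside the domain. *)
Definition local_potential a x : R :=
  if [pick K | `[< elt K a /\ elt K x >]] is Some K then dot (w K) (x - a) else 0.

Lemma local_potentialE K a x : elt K a -> elt K x ->
  local_potential a x = dot (w K) (x - a).
Proof.
move=> Ka Kx; rewrite /local_potential; case: pickP => [L /asboolP[La Lx]|/(_ K)].
  exact: w_agree.
by move/asboolP; case.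
Qed.

Lemma local_potential_out a x : ~ closure Omega x -> local_potential a x = 0.
Proof.
move=> nx; rewrite /local_potential; case: pickP => [L /asboolP[_ Lx]|//].
by case: nx; exact: (elt_closure hM Lx).
Qed.

Section transition.
Variables (p p' : R * R) (r r' : R) (a b : R * R).
Hypothesis ha : same_faces p r a.
Hypothesis hb : same_faces p' r' b.
Let V := ball p r `&` ball p' r'.

(** If [y] is in an element [L], both [K] and [L] contain [a] and [b], and [w_agree] applies. If [y]
    is outside the domain, both potentials vanish at [y]; the segment from [x] to [y] meets a
    boundary edge inside both balls, that edge contains [a] and [b], and the field has no component
    along it. *)
Let trans1 K x y : V x -> elt K x -> V y ->
  local_potential a y - local_potential b y = dot (w K) (b - a).
Proof.
move=> [x1 x2] Kx [y1 y2].
have Ka := ha.1 _ _ x1 Kx; have Kb := hb.1 _ _ x2 Kx.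
have inL L : elt L y ->
    local_potential a y - local_potential b y = dot (w L) (b - a).
  move=> Ly; have La := ha.1 _ _ y1 Ly; have Lb := hb.1 _ _ y2 Ly.
  by rewrite (local_potentialE La Ly) (local_potentialE Lb Ly) !dotBr; ring.
have [/(closure_elt hM)[L Ly]|ny] := pselect (closure Omega y).
  have La := ha.1 _ _ y1 Ly; have Lb := hb.1 _ _ y2 Ly.
  by rewrite (inL L)//; exact: w_agree.
rewrite !local_potential_out// subrr.
have Ox : closure Omega x := elt_closure hM Kx.
have [t t01 zb] := segment_meets_bdry Oo Ox ny.
have [L [i [Lz eb]]] := bdry_edge hM hO zb.
have z1 : ball p r (lerp x y t) by exact: ball_lerp.
have z2 : ball p' r' (lerp x y t) by exact: ball_lerp.
have La := ha.2 _ _ _ z1 Lz; have Lb := hb.2 _ _ _ z2 Lz.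
rewrite (w_agree (L := L))//; try exact: edge_elt La; try exact: edge_elt Lb.
by have [s ->] := edge_diff La Lb; rewrite dotZr w_bdry// mulr0.
Qed.

Lemma local_potential_trans x y : V x -> V y ->
  local_potential a x - local_potential b x =
  local_potential a y - local_potential b y.
Proof.
move=> Vx Vy.
have [/(closure_elt hM)[K Kx]|nx] := pselect (closure Omega x).
  by rewrite (trans1 Vx Kx Vx) (trans1 Vx Kx Vy).
have [/(closure_elt hM)[K Ky]|ny] := pselect (closure Omega y).
  by rewrite (trans1 Vy Ky Vx) (trans1 Vy Ky Vy).
by rewrite !local_potential_out.
Qed.

End transition.

(** The boundary edge through [x] also contains the base point [a], and the field has no component
    along it. *)
Lemma local_potential_bdry p r a x : same_faces p r a -> ball p r x ->
  bdry Omega x -> local_potential a x = 0.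
Proof.
move=> h px /(bdry_edge hM hO)[K [i [Kx eb]]].
have Ka := h.2 _ _ _ px Kx.
rewrite (local_potentialE (K := K)); try exact: edge_elt Ka; try exact: edge_elt Kx.
by have [s ->] := edge_diff Ka Kx; rewrite dotZr w_bdry// mulr0.
Qed.

Lemma mesh_potential_local : exists u : R * R -> R, exists2 d, 0 < d &
  (forall K x y, elt K x -> elt K y -> `|x - y| < d ->
     u y - u x = dot (w K) (y - x)) /\
  (forall x y, bdry Omega x -> bdry Omega y -> `|x - y| < d -> u x = u y).
Proof.
have [rho hrho] := bounded_closure.
have [r r0 hr] := same_faces_uniform rho.
have [a ha] : exists a : R * R -> R * R,
    forall p, `|p| <= rho -> same_faces p r (a p).
  have /choice[a ha] : forall p, exists a, `|p| <= rho -> same_faces p r a.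
    move=> p; have [/hr[a h]|h] := pselect (`|p| <= rho); first by exists a.
    by exists 0 => /h.
  by exists a.
(* The potentials based at [a p] and [a q] differ by a constant where the balls around [p] and [q]
   overlap, so these increments form a cocycle. *)
pose c p q := local_potential (a p) q - local_potential (a p) p.
have [|u [d d0 hu]] := @cocycle_potential R c r rho r0.
  move=> p q s pr qr sr pq qs ps; rewrite /c.
  have Vq : (ball p r `&` ball q r) q.
    by split; [exact/ball_prodE|exact: ballxx].
  have Vs : (ball p r `&` ball q r) s by split; exact/ball_prodE.
  have := local_potential_trans (ha _ pr) (ha _ qr) Vq Vs.
  lra.
exists u, (Num.min d r); first by rewrite lt_min d0.
split=> [K x y Kx Ky|x y bx by_]; rewrite lt_min => /andP[xd xr].
  have nx := hrho _ (elt_closure hM Kx); have ny := hrho _ (elt_closure hM Ky).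
  rewrite hu// /c; have Ka := (ha _ nx).1 _ _ (ballxx _ r0) Kx.
  by rewrite !(local_potentialE Ka)// !dotBr; ring.
have nx := hrho _ bx.1; have ny := hrho _ by_.1.
apply/esym/subr0_eq; rewrite hu// /c.
have xy : ball x r y by apply/ball_prodE.
rewrite (local_potential_bdry (ha _ nx) xy by_).
by rewrite (local_potential_bdry (ha _ nx) (ballxx x r0) bx) subrr.
Qed.

(** Elements are convex and the sides of the boundary polygon are segments, so [segment_chain] makes
    the increments global on each. Consecutive sides share a vertex, hence the potential is constant
    on the boundary, and this constant is subtracted. *)
Lemma mesh_potential : exists u : R * R -> R,
  (forall K x y, elt K x -> elt K y -> u y - u x = dot (w K) (y - x)) /\
  (forall x, bdry Omega x -> u x = 0).
Proof.
have [u [d d0 [uK ub]]] := mesh_potential_local.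
have uK' K x y : elt K x -> elt K y -> u y - u x = dot (w K) (y - x).
  move=> Kx Ky; apply: (segment_chain d0) => s t s01 t01 st.
  rewrite (uK K)//; [|exact: (elt_lerp nd)..].
  by rewrite lerpB dotZr.
suff ubc x y : bdry Omega x -> bdry Omega y -> u x = u y.
  have [[x0 x0b]|nb] := pselect (bdry Omega !=set0).
    exists (fun x => u x - u x0); split=> [K x y Kx Ky|x xb].
      by rewrite -(uK' K)//; ring.
    by rewrite (ubc x x0)// subrr.
  by exists u; split=> // x xb; case: nb; exists x.
case: hO => _ _ _ _ [m [P [_ bE]]].
have side (i : 'I_m) (s t : R) : 0 <= s <= 1 -> 0 <= t <= 1 ->
    u (lerp (P i) (P (ordS i)) s) = u (lerp (P i) (P (ordS i)) t).
  move=> s01 t01; apply/eqP; rewrite -subr_eq0; apply/eqP.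
  apply: (segment_chain d0) => v v' v01 v'01 vv; rewrite mulr0.
  have onb z : 0 <= z <= 1 -> bdry Omega
      (lerp (lerp (P i) (P (ordS i)) t) (lerp (P i) (P (ordS i)) s) z).
    move=> z01; rewrite bE; exists i => //; exists (t + z * (s - t)).
      by rewrite /= in_itv /=; move: s01 t01 z01 => /andP[? ?] /andP[? ?] /andP[? ?]; nra.
    by apply: pairP; rewrite /lerp /= /GRing.scale /=; ring.
  by apply/eqP; rewrite subr_eq0 eq_sym; apply/eqP/ub => //; exact: onb.
have h01 : 0 <= (0 : R) <= 1 by rewrite lexx ler01.
have h11 : 0 <= (1 : R) <= 1 by rewrite lexx ler01.
have step (i : 'I_m) : u (P (ordS i)) = u (P i).
  by have := side i 1 0 h11 h01; rewrite lerp0 lerp1.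
have vert (i j : 'I_m) : u (P i) = u (P j).
  have m0 : (0 < m)%N by apply: leq_ltn_trans (ltn_ord i).
  suff H k (hk : (k < m)%N) : u (P (Ordinal hk)) = u (P (Ordinal m0)).
    case: i => k hk; case: j => l hl; by rewrite !H.
  elim: k hk => [|k IH] hk; first by congr (u (P _)); exact: val_inj.
  rewrite -(IH (ltnW hk)) -(step (Ordinal (ltnW hk))); congr (u (P _)).
  apply: val_inj => /=.
  by rewrite modn_small.
rewrite !bE => -[i _ [s + <-]] [j _ [t + <-]].
rewrite /= !in_itv /= => s01 t01.
by rewrite (side i s 0)// (side j t 0)// !lerp0.
Qed.
End mesh_potential.

(** * Integrals of traces along edges *)

Section step_function.
Variable R : realType.
Notation leb := (@lebesgue_measure R).

Lemma step_integral (f : R -> R) (s0 C1 C2 : R) : 0 <= s0 <= 1 ->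
  (forall s, 0 <= s <= 1 -> s < s0 -> f s = C1) ->
  (forall s, 0 <= s <= 1 -> s0 < s -> f s = C2) ->
  leb.-integrable `[0, 1] (EFin \o f) /\
  \int[leb]_(s in `[0, 1]) f s = C1 * s0 + C2 * (1 - s0).
Proof.
move=> /andP[s00 s01] f1 f2.
(* [f] is prescribed only on [0, 1] and off [s0]; [g] is a measurable step function on the whole
   line that equals [f] on [0, 1], its value at [s0] included. *)
pose g s := if s < s0 then C1 else if s <= s0 then f s0 else C2.
have fg s : 0 <= s <= 1 -> f s = g s.
  move=> h; rewrite /g; case: ltP => [|]; first exact: f1.
  by rewrite le_eqVlt => /orP[/eqP <-|s0s]; rewrite ?lexx// leNgt s0s f2.
have mg : measurable_fun setT g.
  apply: measurable_fun_ifT => //; first exact: measurable_realfun.measurable_fun_ltr.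
  by apply: measurable_fun_ifT => //; exact: measurable_realfun.measurable_fun_ler.
have gb : [bounded g s | s in (`[0, 1]%classic : set R)].
  exists (`|C1| + `|f s0| + `|C2|); split; rewrite ?num_real// => r hr s _ /=.
  apply: le_trans (ltW hr).
  have [h1 h2 h3] : [/\ 0 <= `|C1|, 0 <= `|f s0| & 0 <= `|C2|] by [].
  by rewrite /g; case: ifP => _; [|case: ifP => _]; lra.
have ig : leb.-integrable `[0, 1] (EFin \o g).
  apply: measurable_bounded_integrable => //=.
    by rewrite lebesgue_measure_itv /= lte01 oppr0 adde0 ltry.
  exact: measurable_funTS.
have fgi : {in (`[0, 1]%classic : set R), f =1 g}.
  by move=> s; rewrite inE /= in_itv /=; exact: fg.
have if_ : leb.-integrable `[0, 1] (EFin \o f).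
  apply: eq_integrable ig => //= s /fgi /= ->; by [].
split=> //.
have I1 : \int[leb]_(s in `[0, s0]) f s = C1 * s0.
  rewrite -Rintegral_itv_bndo_bndc; last first.
    apply: integrableS if_ => // s /=; rewrite !in_itv /= => /andP[-> h] /=.
    exact: le_trans (ltW h) s01.
  transitivity (\int[leb]_(s in `[0, s0[) C1).
    apply: eq_Rintegral => s; rewrite inE /= in_itv /= => /andP[h1 h2].
    by apply: f1 => //; rewrite h1 (le_trans (ltW h2)).
  rewrite Rintegral_cst//= lebesgue_measure_itv /= lte_fin.
  by move: s00; rewrite le_eqVlt => /orP[/eqP <-|->]; rewrite ?ltxx ?mulr0//= subr0.
have I2 : \int[leb]_(s in `]s0, 1]) f s = C2 * (1 - s0).
  transitivity (\int[leb]_(s in `]s0, 1]) C2).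
    apply: eq_Rintegral => s; rewrite inE /= in_itv /= => /andP[h1 h2].
    by apply: f2 => //; rewrite h2 (le_trans s00 (ltW h1)).
  rewrite Rintegral_cst//= lebesgue_measure_itv /= lte_fin.
  by move: s01; rewrite le_eqVlt => /orP[/eqP ->|->]; rewrite ?ltxx ?subrr ?mulr0.
have := Rintegral_itvB (x := s0) if_.
rewrite !bnd_simp s00 s01 => /(_ isT isT).
by rewrite I1 I2 => /eqP; rewrite subr_eq addrC => /eqP.
Qed.

(* [s0] is the zero in [0, 1] of [s |-> (1 - s) * a + s * b], or 0 if there is
   none. *)
Lemma affine_sign_change (a b : R) : a != 0 \/ b != 0 ->
  exists s0, [/\ 0 <= s0 <= 1,
    forall s, 0 <= s <= 1 -> s < s0 -> (1 - s) * a + s * b != 0 /\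
      (0 < (1 - s) * a + s * b) = (0 < a),
    forall s, 0 <= s <= 1 -> s0 < s -> (1 - s) * a + s * b != 0 /\
      (0 < (1 - s) * a + s * b) = (0 < b)
    & (if 0 < a then b - a else 0) * s0 + (if 0 < b then b - a else 0) * (1 - s0)
      = Num.max b 0 - Num.max a 0].
Proof.
move=> ab.
have same (u v : R) : 0 < u * v -> u != 0 /\ (0 < u) = (0 < v).
  move=> uv; split; first by apply: contraTneq uv => ->; rewrite mul0r ltxx.
  by case: (ltP 0 u) => h; case: (ltP 0 v) => h' //; nra.
have maxP (u : R) : 0 < u -> Num.max u 0 = u by move=> /ltW/max_idPl.
have maxN (u : R) : u < 0 -> Num.max u 0 = 0 by move=> /ltW/max_idPr.
have [a0|a0] := eqVneq a 0.
  case: ab => [|b0]; first by rewrite a0 eqxx.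
  have bb : 0 < b * b by rewrite -expr2 exprn_even_gt0.
  exists 0; split.
  - by rewrite lexx ler01.
  - by move=> s /andP[h _]; rewrite ltNge h.
  - by move=> s _ s0; apply: same; rewrite a0; nra.
  - by rewrite a0 ltxx maxxx /Num.max; case: (ltP 0 b) => h; case: (ltP b 0) => h'; lra.
have aa : 0 < a * a by rewrite -expr2 exprn_even_gt0.
have [b0|b0] := eqVneq b 0.
  exists 1; split.
  - by rewrite lexx ler01.
  - by move=> s /andP[h _] s1; apply: same; rewrite b0; nra.
  - by move=> s /andP[_ h]; rewrite ltNge h.
  - by rewrite b0 ltxx maxxx /Num.max; case: (ltP 0 a) => h; case: (ltP a 0) => h'; lra.
have bb : 0 < b * b by rewrite -expr2 exprn_even_gt0.
have [ab0|ab0] := ltP 0 (a * b).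
  exists 0; split.
  - by rewrite lexx ler01.
  - by move=> s /andP[h _]; rewrite ltNge h.
  - move=> s /andP[h h'] s0; apply: same.
    have : 0 <= (1 - s) * (a * b) by rewrite mulr_ge0 ?subr_ge0// ltW.
    have : 0 < s * (b * b) by rewrite mulr_gt0.
    lra.
  - move: a0; rewrite neq_lt => /orP[] h.
      have h' : b < 0 by rewrite -(nmulr_rgt0 _ h).
      by rewrite !(lt_gtF h) !(lt_gtF h') !maxN// !mul0r addr0 subrr.
    have h' : 0 < b by rewrite -(pmulr_rgt0 _ h).
    by rewrite h h' !maxP// mulr0 add0r subr0 mulr1.
have d0 : a - b != 0 by rewrite subr_eq0; apply: contraTneq ab0 => ->; rewrite -ltNge.
have dd : 0 < (a - b) ^+ 2 by rewrite exprn_even_gt0.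
pose s0 := a / (a - b).
have s0E : a = s0 * (a - b) by rewrite /s0 divfK.
have s0b : - b = (1 - s0) * (a - b) by rewrite mulrBl -s0E; ring.
have val s : (1 - s) * a + s * b = (s0 - s) * (a - b).
  by rewrite [in RHS]mulrBl -s0E; ring.
have s00 : 0 < s0.
  have : 0 < s0 * (a - b) ^+ 2 by rewrite expr2 mulrA -s0E; nra.
  by rewrite pmulr_lgt0.
have s01 : 0 < 1 - s0.
  have : 0 < (1 - s0) * (a - b) ^+ 2 by rewrite expr2 mulrA -s0b; nra.
  by rewrite pmulr_lgt0.
exists s0; split.
- by rewrite ltW//= -subr_ge0 ltW.
- move=> s _ ss; apply: same; rewrite val [X in _ * X]s0E.
  have -> : (s0 - s) * (a - b) * (s0 * (a - b)) = (s0 - s) * (s0 * (a - b) ^+ 2) by ring.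
  by rewrite mulr_gt0 ?subr_gt0// mulr_gt0.
- move=> s _ ss; apply: same; rewrite val.
  have hb : b = (s0 - 1) * (a - b) by rewrite [in RHS]mulrBl -s0E; ring.
  have -> : (s0 - s) * (a - b) * b = (s - s0) * ((1 - s0) * (a - b) ^+ 2).
    by rewrite [X in _ * X = _]hb; ring.
  by rewrite mulr_gt0 ?subr_gt0// mulr_gt0.
- move: a0; rewrite neq_lt => /orP[] h.
    have h' : 0 < b.
      by rewrite lt_neqAle eq_sym b0 -(nmulr_rle0 _ h).
    rewrite (lt_gtF h) h' maxP// maxN// mul0r add0r subr0.
    by rewrite mulrC -(opprB a b) mulrN -s0b opprK.
  have h' : b < 0 by rewrite lt_neqAle b0 -(pmulr_rle0 _ h).
  rewrite h (lt_gtF h') maxN// maxP// mul0r addr0 sub0r.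
  by rewrite mulrC -(opprB a b) mulrN -s0E.
Qed.

End step_function.

(** * Local spaces *)

Section affine_derivatives.
Variable R : realType.
Implicit Types (x y v g : R * R).

Lemma derive_affine (f : R * R -> R) (c : R) g x v :
  (\forall y \near x, f y = c + dot g y) -> 'D_v f x = dot g v.
Proof.
move=> /near_eq_derive ->; rewrite /derive; apply: cvg_lim => //.
apply: cvg_near_cst; near=> h.
have h0 : h != 0 by near: h; exact: nbhs_dnbhs_neq.
rewrite /= dotDr dotZr /GRing.scale /=; field; exact: h0.
Unshelve. all: by end_near.
Qed.

Lemma grad_affine (f : R * R -> R) (c : R) g x :
  (\forall y \near x, f y = c + dot g y) -> grad f x = g.
Proof.
move=> h; rewrite /grad !(derive_affine _ h).
by apply: pairP; rewrite /dot /=; ring.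
Qed.

Lemma curl_ND (w : R * R -> R * R) a (b : R) x :
  (\forall y \near x, w y = a + b *: (y.2, - y.1)) -> curl w x = - (2 * b).
Proof.
move=> h; rewrite /curl.
rewrite (@derive_affine _ a.2 (- b, 0)); last first.
  by apply: filterS h => y ->; rewrite /dot /= /GRing.scale /=; ring.
rewrite (@derive_affine _ a.1 (0, b)); last first.
  by apply: filterS h => y ->; rewrite /dot /= /GRing.scale /=; ring.
rewrite /dot /=; ring.
Qed.

Lemma curl_cst (w : R * R -> R * R) a x :
  (\forall y \near x, w y = a) -> curl w x = 0.
Proof.
move=> h; rewrite (@curl_ND _ a 0) ?mulr0 ?oppr0//.
by apply: filterS h => y ->; rewrite scale0r addr0.
Qed.

Lemma curl_const a x : curl (cst a) x = 0.
Proof.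
by apply: (@curl_cst _ a); apply: (@filterS _ (nbhs x) _ setT); [|exact: filterT].
Qed.

End affine_derivatives.

Section local_spaces.
Variables (R : realType) (M : mesh R) (Gamma Om Op : set (R * R)).
Implicit Types (K L : 'I_(nelt M)) (i j : 'I_3) (x y a b g : R * R) (c al : R).
Hypothesis nd : forall K, orient K != 0.
Hypothesis hcut : cut_by_interface M Gamma Om Op.

Lemma cut_dist_P1 K : P1 (cut_dist K).
Proof.
exists (- dot (ptD K) (nrm K)), (nrm K) => x.
by rewrite /cut_dist /dot /=; ring.
Qed.

Let dc K : continuous (cut_dist K) := P1_continuous (cut_dist_P1 K).

Lemma cut_distB K x y : cut_dist K x - cut_dist K y = dot (nrm K) (x - y).
Proof. by rewrite /cut_dist /dot /=; ring. Qed.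

Lemma nrm_unit K : interface_elt Gamma K -> dot (nrm K) (nrm K) = 1.
Proof. by move=> /hcut[_ _ []]. Qed.

Lemma nrm_decomp K g : interface_elt Gamma K -> dot g (cut_tangent K) = 0 ->
  g = dot g (nrm K) *: nrm K.
Proof.
move=> /nrm_unit; rewrite /cut_tangent /dot /=; set n := nrm K => n1 gt.
apply: pairP; rewrite /= /GRing.scale /=.
  rewrite -[LHS]mulr1 -n1.
  have -> : g.1 * (n.1 * n.1 + n.2 * n.2) = (g.1 * n.1 + g.2 * n.2) * n.1
    - (g.1 * - n.2 + g.2 * n.1) * n.2 by ring.
  by rewrite gt mul0r subr0.
rewrite -[LHS]mulr1 -n1.
have -> : g.2 * (n.1 * n.1 + n.2 * n.2) = (g.1 * n.1 + g.2 * n.2) * n.2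
  + (g.1 * - n.2 + g.2 * n.1) * n.1 by ring.
by rewrite gt mul0r addr0.
Qed.

Lemma cut_tangent_perp K x y : interface_elt Gamma K ->
  cut_dist K x = 0 -> cut_dist K y = 0 ->
  exists t, x - y = t *: cut_tangent K.
Proof.
move=> hK x0 y0; have := cut_distB K x y; rewrite x0 y0 subrr => /esym e.
exists (dot (x - y) (cut_tangent K)).
have := nrm_unit hK; move: e; rewrite /cut_tangent /dot.
move: (x - y) (nrm K) => h n /= e n1.
apply: pairP; rewrite /= /GRing.scale /=.
  rewrite -[LHS]mulr1 -n1.
  have -> : h.1 * (n.1 * n.1 + n.2 * n.2) = (n.1 * h.1 + n.2 * h.2) * n.1
    + (h.1 * - n.2 + h.2 * n.1) * - n.2 by ring.
  by rewrite e mul0r add0r.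
rewrite -[LHS]mulr1 -n1.
have -> : h.2 * (n.1 * n.1 + n.2 * n.2) = (n.1 * h.1 + n.2 * h.2) * n.2
  + (h.1 * - n.2 + h.2 * n.1) * n.1 by ring.
by rewrite e mul0r add0r.
Qed.

Lemma cut_dist_ptD K : cut_dist K (ptD K) = 0.
Proof. by rewrite /cut_dist subrr dot0l. Qed.

Lemma cut_dist_ptE K : interface_elt Gamma K -> cut_dist K (ptE K) = 0.
Proof. by move=> /hcut[_ _ []]. Qed.

(* The common form of the functions of the two spaces on an element: [pw] is
   continuous and piecewise linear with gradient [pwg], whose jump across the
   cut segment is normal. *)
Definition pw K g al x : R := dot g x + al * Num.max (cut_dist K x) 0.

Definition pwg K g al x : R * R :=
  g + (if 0 < cut_dist K x then al else 0) *: nrm K.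

Definition smooth_at K al x := al = 0 \/ cut_dist K x <> 0.

Lemma pw_continuous K g al : continuous (pw K g al).
Proof.
move=> x; apply: cvgD; first exact: dot_continuous.
apply: cvgM; first exact: cvg_cst.
by apply: continuous_max; [exact: dc|exact: cvg_cst].
Qed.

Lemma pwg_eq K g al x y : (0 < cut_dist K x) = (0 < cut_dist K y) ->
  pwg K g al x = pwg K g al y.
Proof. by rewrite /pwg => ->. Qed.

Lemma pwg0 K g x : pwg K g 0 x = g.
Proof. by rewrite /pwg if_same scale0r addr0. Qed.

Lemma pwB K g al x y :
  al = 0 \/ (0 < cut_dist K x) = (0 < cut_dist K y) ->
  pw K g al x - pw K g al y = dot (pwg K g al y) (x - y).
Proof.
move=> [->|]; first by rewrite pwg0 /pw !mul0r !addr0 dotBr.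
rewrite /pw /pwg /Num.max; have := cut_distB K x y.
rewrite dotDl dotZl => <-; rewrite dotBr.
case: (ltP 0 (cut_dist K x)); case: (ltP 0 (cut_dist K y)) => // h1 h2 _.
  by rewrite (lt_gtF h1) (lt_gtF h2); ring.
rewrite mul0r addr0.
have e z : cut_dist K z <= 0 -> (if cut_dist K z < 0 then 0 else cut_dist K z) = 0.
  by move=> h; case: ltP => // h'; apply/eqP; rewrite eq_le h h'.
by rewrite !e//; ring.
Qed.

Lemma smooth_at_near K al x : smooth_at K al x ->
  \forall y \near x, al = 0 \/ (0 < cut_dist K y) = (0 < cut_dist K x).
Proof.
move=> [->|/eqP].
  by apply: (@filterS _ (nbhs x) _ setT); [move=> y _; left|exact: filterT].
rewrite neq_lt => /orP[] h.
  apply: filterS (near_lt (@dc K x) h) => y hy; right.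
  by rewrite (lt_gtF h) (lt_gtF hy).
by apply: filterS (near_gt (@dc K x) h) => y hy; right; rewrite h hy.
Qed.

Lemma pwg_const K g al x y : al = 0 \/ (0 < cut_dist K x) = (0 < cut_dist K y) ->
  pwg K g al x = pwg K g al y.
Proof. by case=> [->|/pwg_eq]; rewrite ?pwg0. Qed.

Lemma pieces_open K : open (pieces Gamma K).
Proof.
have [hK|hK] := pselect (interface_elt Gamma K); last first.
  rewrite (_ : pieces Gamma K = (elt K)°); first exact: open_interior.
  by apply/seteqP; split=> x; [case|move=> xK; split].
rewrite (_ : pieces Gamma K = (elt K)° `&` ~` (cut_dist K @^-1` [set 0])).
  apply: openI; first exact: open_interior.
  apply: closed_openC; apply: preimage_closed => [x _|]; first exact: dc.
  exact: closed_eq.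
by apply/seteqP; split=> x [h1 h2]; split=> //; exact: h2.
Qed.

Lemma pieces_point K : exists x, pieces Gamma K x.
Proof.
have [x xK] := barycenter_interior nd K.
have [hK|hK] := pselect (interface_elt Gamma K); last by exists x; split.
have [d0|d0] := pselect (cut_dist K x = 0); last by exists x; split.
have cont : continuous (fun t : R => x + t *: nrm K).
  move=> t; apply: cvgD; first exact: cvg_cst.
  by apply: cvgZr_tmp; exact: cvg_id.
have := cont 0; rewrite /continuous_at scale0r addr0.
move=> /(_ _ (open_nbhs_nbhs (conj (@open_interior _ (elt K)) xK))).
move=> /nbhs_ballP[r /= r0 H]; have {H} /= H := H _ (ball0_half r0).1.
(* In this case [x] is on the cut line; a small step along the unit normal leaves that line but not
   the interior of the element. *)
exists (x + (r / 2) *: nrm K); split=> // _.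
have := cut_distB K (x + (r / 2) *: nrm K) x.
rewrite (addrC x) addrK dotZr nrm_unit// d0 subr0 mulr1 => ->.
by apply/eqP; rewrite gt_eqF// divr_gt0.
Qed.

(** This makes the limit defining a trace unique. From [x], head towards a point [y] of the piece:
    for small [t > 0] the points are interior to [K], and off the cut line since [cut_dist] is
    affine along the way and nonzero at [y]. *)
Lemma pieces_dense K : elt K `<=` closure (pieces Gamma K).
Proof.
move=> x xK; have [y [yK yd]] := pieces_point K.
have lc := @lerp_continuous R x y 0; rewrite /continuous_at lerp0 in lc.
have n1 : \forall t \near (0 : R)^'+, 0 < t <= 1 /\
    (interface_elt Gamma K -> cut_dist K (lerp x y t) <> 0).
  have n0 : \forall t \near (0 : R)^'+, 0 < t <= 1.
    apply: filterS2 (nbhs_right_gt (0 : R)) (nbhs_right_lt ltr01) => t -> /ltW ->.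
    by [].
  have [hK|hK] := pselect (interface_elt Gamma K); last first.
    by apply: filterS n0 => t h; split.
  have lE t : cut_dist K (lerp x y t) = (1 - t) * cut_dist K x + t * cut_dist K y.
    by rewrite P1_lerp//; exact: cut_dist_P1.
  have [d0|/eqP d0] := pselect (cut_dist K x = 0).
    apply: filterS n0 => t /[dup] h /andP[t0 _]; split=> // _.
    rewrite lE d0 mulr0 add0r => /eqP; rewrite mulf_eq0 (gt_eqF t0) /=.
    by move/eqP; exact: yd.
  have o : open (~` (cut_dist K @^-1` [set 0])).
    apply: closed_openC; apply: preimage_closed => [z _|]; first exact: dc.
    exact: closed_eq.
  have nx : nbhs x (~` (cut_dist K @^-1` [set 0])).
    by apply: open_nbhs_nbhs; split=> //; exact/eqP.
  have n2 := lc _ nx.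
  have n3 : \forall t \near (0 : R)^'+, cut_dist K (lerp x y t) <> 0.
    exact: (@filterS _ (nbhs (0 : R)) _ _ _ (fun t ht _ => ht) n2).
  by apply: filterS2 n0 n3 => t.
move=> B Bx; have n2 := lc _ Bx.
have n3 : \forall t \near (0 : R)^'+, B (lerp x y t).
  exact: (@filterS _ (nbhs (0 : R)) _ _ _ (fun t ht _ => ht) n2).
have [t [[t01 td] Bt]] := filter_ex (filterI n1 n3).
by exists (lerp x y t); split=> //; split=> //; exact: (interior_lerp nd).
Qed.

Lemma trace_eq (U : normedModType R) K (v F : R * R -> U) x : elt K x ->
  (\forall y \near x, pieces Gamma K y -> v y = F y) ->
  {for x, continuous F} -> trace Gamma K v x = F x.
Proof.
move=> xK vF Fc; rewrite /trace.
have pf : ProperFilter (within (pieces Gamma K) (nbhs x)).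
  by apply: within_nbhs_proper; exact: pieces_dense.
apply: cvg_lim; first exact: norm_hausdorff.
apply: (@cvg_trans _ (F y @[y --> within (pieces Gamma K) (nbhs x)])).
  by apply: near_eq_cvg; apply: filterS vF => y /[apply].
exact: cvg_within_filter.
Qed.

Lemma trace_pw K (u : R * R -> R) c g al x : elt K x ->
  (forall y, pieces Gamma K y -> u y = c + pw K g al y) ->
  trace Gamma K (u : R * R -> R^o) x = c + pw K g al x.
Proof.
move=> xK uE; apply: (@trace_eq R^o K u (fun y => c + pw K g al y)) => //.
  by apply: (@filterS _ (nbhs x) _ setT); [move=> y _; exact: uE|exact: filterT].
by apply: cvgD; [exact: cvg_cst|exact: pw_continuous].
Qed.

Lemma trace_pwg K (z : R * R -> R * R) g al x : elt K x ->
  (forall y, pieces Gamma K y -> z y = pwg K g al y) -> smooth_at K al x ->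
  trace Gamma K z x = pwg K g al x.
Proof.
move=> xK zE sx; apply: (@trace_eq _ K z (cst (pwg K g al x))) => //; last first.
  exact: cvg_cst.
by apply: filterS (smooth_at_near sx) => y /pwg_const e yp; rewrite zE.
Qed.

End local_spaces.

(** * Elementwise equivalence of both spaces with the normal forms *)

Section local_conditions.
Variables (R : realType) (M : mesh R) (Gamma Om Op : set (R * R)).
Variables (mum mup bm bp : R).
Implicit Types (K L : 'I_(nelt M)) (i j : 'I_3) (x y a b g : R * R) (c al : R).
Hypothesis nd : forall K, orient K != 0.
Hypothesis hcut : cut_by_interface M Gamma Om Op.
Hypotheses (hmum : 0 < mum) (hmup : 0 < mup).

(** The flux condition between the gradients [g] and [g + al *: nrm K] of the two parts, the normal
    being a unit vector; a non-interface element has no kink. *)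
Definition flux_condition K g al :=
  (~ interface_elt Gamma K -> al = 0) /\
  (interface_elt Gamma K -> bp * (dot g (nrm K) + al) = bm * dot g (nrm K)).

Lemma pieces_smooth K g al x : flux_condition K g al -> pieces Gamma K x ->
  smooth_at K al x.
Proof.
move=> [h _] [_ xd]; have [hK|hK] := pselect (interface_elt Gamma K).
  by right; exact: xd.
by left; exact: h.
Qed.

Lemma near_pieces K x : pieces Gamma K x -> \forall y \near x, pieces Gamma K y.
Proof. by move=> xp; apply: open_nbhs_nbhs; split=> //; exact: pieces_open. Qed.

Lemma curl_pieces K z g al : flux_condition K g al ->
  (forall x, pieces Gamma K x -> z x = pwg K g al x) ->
  forall x, pieces Gamma K x -> curl z x = 0.
Proof.
move=> fl zE x xp; apply: (@curl_cst _ _ (pwg K g al x)).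
apply: filterS2 (near_pieces xp) (smooth_at_near (pieces_smooth fl xp)).
by move=> y yp /pwg_const e; rewrite zE.
Qed.

Lemma grad_pieces K u c g al : flux_condition K g al ->
  (forall x, pieces Gamma K x -> u x = c + pw K g al x) ->
  forall x, pieces Gamma K x -> grad u x = pwg K g al x.
Proof.
move=> fl uE x xp.
apply: (@grad_affine _ _ (c + pw K g al x - dot (pwg K g al x) x)).
apply: filterS2 (near_pieces xp) (smooth_at_near (pieces_smooth fl xp)).
move=> y yp /pwB e; rewrite uE//.
have := e g; rewrite dotBr => e'; lra.
Qed.

Lemma grad_P1 (f : R * R -> R) c g x : (forall y, f y = c + dot g y) ->
  grad f x = g.
Proof.
move=> h; apply: (@grad_affine _ _ c).
by apply: (@filterS _ (nbhs x) _ setT); [move=> y _; exact: h|exact: filterT].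
Qed.

Lemma pwg_neg K g al x : cut_dist K x < 0 -> pwg K g al x = g.
Proof. by move=> h; rewrite /pwg (lt_gtF h) scale0r addr0. Qed.

Lemma pwg_pos K g al x : 0 < cut_dist K x -> pwg K g al x = g + al *: nrm K.
Proof. by rewrite /pwg => ->. Qed.

Lemma pw_neg K g al x : cut_dist K x <= 0 -> pw K g al x = dot g x.
Proof. by move=> h; rewrite /pw (max_idPr h) mulr0 addr0. Qed.

Lemma pw_pos K g al x : 0 <= cut_dist K x ->
  pw K g al x = dot g x + al * cut_dist K x.
Proof. by move=> h; rewrite /pw (max_idPl h). Qed.

Lemma pieces_glued (U : Type) K (v f fm fp : R * R -> U) :
  interface_elt Gamma K -> (forall x, pieces Gamma K x -> v x = f x) ->
  (forall x, cut_dist K x < 0 -> f x = fm x) ->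
  (forall x, 0 < cut_dist K x -> f x = fp x) -> glued K v fm fp.
Proof.
move=> hK vf hm hp x xK; split=> h.
  by rewrite vf ?hm//; split=> // _; apply/eqP; rewrite lt_eqF.
by rewrite vf ?hp//; split=> // _; apply/eqP; rewrite gt_eqF.
Qed.

Lemma glued_pieces (U : Type) K (v f fm fp : R * R -> U) :
  interface_elt Gamma K -> glued K v fm fp ->
  (forall x, cut_dist K x < 0 -> f x = fm x) ->
  (forall x, 0 < cut_dist K x -> f x = fp x) ->
  forall x, pieces Gamma K x -> v x = f x.
Proof.
move=> hK hg hm hp x [xK /(_ hK)/eqP]; have [h1 h2] := hg x xK.
by rewrite neq_lt => /orP[] h; [rewrite h1// hm|rewrite h2// hp].
Qed.

Lemma cut_segment_dist K x : interface_elt Gamma K -> cut_segment K x ->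
  cut_dist K x = 0.
Proof.
move=> hK [s _ <-]; rewrite P1_lerp; last exact: cut_dist_P1.
by rewrite cut_dist_ptD (cut_dist_ptE hcut hK) !mulr0 addr0.
Qed.

Lemma IND_loc_pwg K z g al : flux_condition K g al ->
  (forall x, pieces Gamma K x -> z x = pwg K g al x) ->
  IND_loc Gamma mum mup bm bp K z.
Proof.
move=> [fl0 fl] zE; split=> hK; last first.
  exists (cst g); split; first by exists g, 0 => x; rewrite scale0r addr0.
  by move=> x xK; rewrite zE ?fl0 ?pwg0//; split.
exists (cst g), (cst (g + al *: nrm K)); split.
- by exists g, 0 => x; rewrite scale0r addr0.
- by exists (g + al *: nrm K), 0 => x; rewrite scale0r addr0.
- split=> [x _|x|].
  + by rewrite /dot /cut_tangent /= /GRing.scale /=; ring.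
  + by rewrite !curl_const !mulr0.
  + by rewrite /= dotDl dotZl (nrm_unit hcut hK) mulr1; exact: fl.
- apply: (pieces_glued hK zE) => x h; [exact: pwg_neg|exact: pwg_pos].
Qed.

Lemma ND_curl (w : R * R -> R * R) x : ND w -> curl w x = 0 ->
  exists a, w = cst a.
Proof.
move=> [a [b wE]] c0; exists a; apply/funext => y; rewrite wE.
have := @curl_ND _ w a b x; rewrite c0.
have n : \forall y \near x, w y = a + b *: (y.2, - y.1).
  by apply: (@filterS _ (nbhs x) _ setT); [move=> ? _; exact: wE|exact: filterT].
move=> /(_ n) e; have -> : b = 0 by lra.
by rewrite scale0r addr0.
Qed.

Lemma curl_glue (v w : R * R -> R * R) x :
  (\forall y \near x, v y = w y) -> curl v x = curl w x.
Proof.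
move=> h; rewrite /curl; congr (_ - _); apply: near_eq_derive.
  by apply: filterS h => y ->.
by apply: filterS h => y ->.
Qed.

(** On an interface element, a point of the pieces gives a vanishing curl on its side of the cut,
    and the curl condition of [CT] carries this to the other side. Both parts are then constant
    fields, and tangential continuity makes their jump normal. *)
Lemma pwg_IND_loc K z : IND_loc Gamma mum mup bm bp K z ->
  (forall x, pieces Gamma K x -> curl z x = 0) ->
  exists g al, flux_condition K g al /\
    forall x, pieces Gamma K x -> z x = pwg K g al x.
Proof.
move=> [hI hN] z0; have [p pp] := pieces_point nd hcut K.
have [hK|hK] := pselect (interface_elt Gamma K); last first.
  have [w [wN zw]] := hN hK.
  have [|g wg] := @ND_curl w p wN.
    rewrite -(z0 p pp); apply/esym/curl_glue.
    by apply: filterS (near_pieces pp) => y [/zw].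
  exists g, 0; split; first by split=> // /hK.
  by move=> x [xK _]; rewrite pwg0 zw// wg.
have [vm [vp [vmN vpN [C1 C2 C3] gl]]] := hI hK.
have [cm cp] : curl vm p = 0 /\ curl vp p = 0.
  have im : mum^-1 != 0 by rewrite invr_eq0 gt_eqF.
  have ip : mup^-1 != 0 by rewrite invr_eq0 gt_eqF.
  suff [h|h] : curl vm p = 0 \/ curl vp p = 0.
  - split=> //; have := C2 p; rewrite h mulr0 => /eqP.
    by rewrite mulf_eq0 (negPf ip) => /eqP.
  - split=> //; have := C2 p; rewrite h mulr0 => /esym/eqP.
    by rewrite mulf_eq0 (negPf im) => /eqP.
  have [pK /(_ hK)/eqP] := pp.
  have nK : nbhs p (elt K)° by apply: open_nbhs_nbhs; split=> //; exact: open_interior.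
  have dc := P1_continuous (cut_dist_P1 K).
  rewrite neq_lt => /orP[] h; [left|right];
    rewrite -(z0 p pp); apply/esym/curl_glue.
    by apply: filterS2 nK (near_lt (@dc p) h) => y yK hy; exact: (gl y yK).1.
  by apply: filterS2 nK (near_gt (@dc p) h) => y yK hy; exact: (gl y yK).2.
have [gm vmE] := ND_curl vmN cm; have [gp vpE] := ND_curl vpN cp.
have jump : gp - gm = dot (gp - gm) (nrm K) *: nrm K.
  apply: (nrm_decomp hcut hK); rewrite dotBl.
  have := C1 (ptD K) (segment_left _ _); rewrite vmE vpE /= => ->.
  by rewrite subrr.
exists gm, (dot (gp - gm) (nrm K)); split.
  split=> // _; rewrite dotBl addrC subrK.
  by move: C3; rewrite vmE vpE.
apply: (glued_pieces hK gl) => x h.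
  by rewrite pwg_neg// vmE.
by rewrite pwg_pos// -jump vpE addrC subrK.
Qed.

Lemma Sh_loc_pw K u c g al : flux_condition K g al ->
  (forall x, pieces Gamma K x -> u x = c + pw K g al x) ->
  Sh_loc Gamma bm bp K u.
Proof.
move=> [fl0 fl] uE; split=> hK; last first.
  exists (fun x => c + dot g x); split; first by exists c, g.
  move=> x xK; rewrite uE; last by split.
  by rewrite fl0// /pw mul0r addr0.
have pE x : c + (dot g x + al * cut_dist K x) =
    c - al * dot (ptD K) (nrm K) + dot (g + al *: nrm K) x.
  by rewrite /cut_dist dotBl dotDl dotZl (dotC x); ring.
exists (fun x => c + dot g x), (fun x => c + (dot g x + al * cut_dist K x)); split.
- by exists c, g.
- by exists (c - al * dot (ptD K) (nrm K)), (g + al *: nrm K).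
- by move=> x /(cut_segment_dist hK) ->; rewrite mulr0 addr0.
- move=> x _; rewrite (grad_P1 x (fun y => erefl)) (grad_P1 x pE).
  by rewrite dotDl dotZl (nrm_unit hcut hK) mulr1 fl.
- apply: (pieces_glued hK uE) => x h; first by rewrite pw_neg// ltW.
  by rewrite pw_pos// ltW.
Qed.

(** On an interface element, agreement at the distinct points [ptD K] and [ptE K] makes the jump of
    the gradients normal, so the two affine parts differ by a multiple of [cut_dist]. *)
Lemma pw_Sh_loc K u : Sh_loc Gamma bm bp K u ->
  exists c g al, flux_condition K g al /\
    forall x, pieces Gamma K x -> u x = c + pw K g al x.
Proof.
move=> [hI hN]; have [hK|hK] := pselect (interface_elt Gamma K); last first.
  have [w [[c [g wE]] uw]] := hN hK.
  exists c, g, 0; split; first by split=> // /hK.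
  by move=> x [xK _]; rewrite /pw mul0r addr0 uw// wE.
have [zm [zp [[cm [gm zmE]] [cp [gp zpE]] zc zf gl]]] := hI hK.
have eD := zc _ (segment_left (ptD K) (ptE K)).
have eE := zc _ (segment_right (ptD K) (ptE K)).
rewrite !zmE !zpE in eD eE.
have DE : ptE K <> ptD K by move=> e; have [[+ _] _ _ _ _] := hcut hK; rewrite e.
have jump : gp - gm = dot (gp - gm) (nrm K) *: nrm K.
  apply: (nrm_decomp hcut hK).
  have [t te] := cut_tangent_perp hcut hK (cut_dist_ptE hcut hK) (cut_dist_ptD K).
  have t0 : t != 0.
    by apply/eqP => t0; apply: DE; apply/subr0_eq; rewrite te t0 scale0r.
  have : t * dot (gp - gm) (cut_tangent K) = 0.
    rewrite -dotZr -te dotBr !dotBl; lra.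
  by move=> /eqP; rewrite mulf_eq0 (negPf t0) => /eqP.
set al := dot (gp - gm) (nrm K) in jump.
exists cm, gm, al; split.
  split=> // _; have := zf _ (segment_left (ptD K) (ptE K)).
  rewrite (grad_P1 _ zmE) (grad_P1 _ zpE) => ->.
  by rewrite /al dotBl addrC subrK.
apply: (glued_pieces hK gl) => x h.
  by rewrite pw_neg ?ltW// zmE.
rewrite pw_pos ?ltW// zpE.
have : dot (gp - gm) (x - ptD K) = al * cut_dist K x.
  by rewrite jump dotZl /cut_dist [in RHS]dotC.
rewrite dotBr !dotBl; lra.
Qed.

(** With both ends of edge [i] on the cut line, [cut_dist] would be a nonzero multiple of coordinate
    [i], so [ptD K] and [ptE K] would both lie on that edge, which [cut_by_interface] forbids. *)
Lemma cut_dist_ends K i (a b : R * R) : interface_elt Gamma K ->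
  edge K i = segment a b -> cut_dist K a != 0 \/ cut_dist K b != 0.
Proof.
move=> hK e; apply: contrapT => /not_orP[/negP/negPn/eqP a0 /negP/negPn/eqP b0].
have [z1 z2] : cut_dist K (vtx K (i + 1)) = 0 /\ cut_dist K (vtx K (i - 1)) = 0.
  by case: (segment_ends e) => -[-> ->].
have dE x : cut_dist K x = bary K i x * cut_dist K (vtx K i).
  rewrite (P1_bary nd K x (cut_dist_P1 K)) (sum_ord3_cyclic _ i) z1 z2.
  by rewrite !mulr0 !addr0.
have [p [_ /(_ hK) pd]] := pieces_point nd hcut K.
have v0 : cut_dist K (vtx K i) != 0.
  by apply/eqP => v0; apply: pd; rewrite dE v0 mulr0.
have [[_ hG] hno _ _ _] := hcut hK.
have on x : (ptD K = x \/ ptE K = x) -> edge K i x.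
  move=> hx; have : (Gamma `&` \bigcup_i edge K i) x.
    by rewrite hG; case: hx => ->; [left|right].
  move=> [_ [j _ /(edge_elt nd) xK]]; apply/(edgeP nd); split=> //.
  have : cut_dist K x = 0.
    by case: hx => <-; rewrite ?cut_dist_ptD ?(cut_dist_ptE hcut hK).
  by rewrite dE => /eqP; rewrite mulf_eq0 (negPf v0) orbF => /eqP.
by apply: (hno i); split; apply: on; [left|right].
Qed.

(** [ptD K] and [ptE K] are in [Omega], so coordinate [i] is positive at both, and the cut line can
    meet the boundary edge only at a point [x] beyond the cut segment. One of the two points is then
    between [x] and the other; an edge of [K] through it would contain the other as well, which is
    forbidden. *)
Lemma cut_dist_bdry (Omega : set (R * R)) K i x : open Omega ->
  Gamma `<=` Omega -> interface_elt Gamma K -> edge K i `<=` bdry Omega ->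
  edge K i x -> cut_dist K x != 0.
Proof.
move=> Oo GO hK eb xe; apply/eqP => x0.
have [[DE hG] hno _ _ _] := hcut hK.
have [GD [jD _ eD]] : (Gamma `&` \bigcup_i edge K i) (ptD K) by rewrite hG; left.
have [GE [jE _ eE]] : (Gamma `&` \bigcup_i edge K i) (ptE K) by rewrite hG; right.
have pos y : Gamma y -> elt K y -> 0 < bary K i y.
  move=> Gy yK; rewrite lt_neqAle ((eltP nd K y).1 yK i) andbT eq_sym.
  apply/eqP => yi; have /eb[_] : edge K i y by apply/(edgeP nd).
  by rewrite (interior_id _).1//; apply; exact: GO.
have DK := edge_elt nd eD; have EK := edge_elt nd eE.
have posD := pos _ GD DK; have posE := pos _ GE EK.
have [xK xi] := (edgeP nd K i x).1 xe.
have [t te] := cut_tangent_perp hcut hK x0 (cut_dist_ptD K).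
have [r re] := cut_tangent_perp hcut hK (cut_dist_ptE hcut hK) (cut_dist_ptD K).
have r0 : r != 0.
  by apply/eqP => r0; apply: DE; apply/esym/subr0_eq; rewrite re r0 scale0r.
have xE : x = lerp (ptD K) (ptE K) (t / r).
  by rewrite /lerp re scalerA divfK// -te addrC subrK.
set s := t / r in xE.
have bE k : bary K k x = (1 - s) * bary K k (ptD K) + s * bary K k (ptE K).
  by rewrite xE P1_lerp//; exact: bary_P1.
have nonneg k : [/\ 0 <= bary K k x, 0 <= bary K k (ptD K) & 0 <= bary K k (ptE K)].
  by rewrite (eltP nd K x).1// (eltP nd K (ptD K)).1// (eltP nd K (ptE K)).1.
have := bE i; rewrite xi => bi.
have [s1|s1] := ltP 1 s.
  apply: (hno jE); split=> //; apply/(edgeP nd); split=> //.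
  have [h1 h2 h3] := nonneg jE; have := bE jE.
  have [_ ->] := (edgeP nd K jE (ptE K)).1 eE; rewrite mulr0 addr0 => h.
  by apply/eqP; rewrite eq_le h2 andbT; nra.
have [s0|s0] := ltP s 0; last by nra.
apply: (hno jD); split=> //; apply/(edgeP nd); split=> //.
have [h1 h2 h3] := nonneg jD; have := bE jD.
have [_ ->] := (edgeP nd K jD (ptD K)).1 eD; rewrite mulr0 add0r => h.
by apply/eqP; rewrite eq_le h3 andbT; nra.
Qed.

End local_conditions.

(** * Exactness *)

Section edges.
Variables (R : realType) (M : mesh R) (Gamma Om Op : set (R * R)) (bm bp : R).
Implicit Types (K L : 'I_(nelt M)) (i j : 'I_3) (x y a b g : R * R) (c al : R).
Hypothesis nd : forall K, orient K != 0.
Hypothesis hcut : cut_by_interface M Gamma Om Op.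
Notation leb := (@lebesgue_measure R).

(** The fundamental theorem of calculus for [pw]: the trace is constant on either side of the
    parameter [s0] where the edge crosses the cut line, and the last clause of [affine_sign_change]
    turns the weighted sum into the increment of the positive part of [cut_dist]. *)
Lemma edge_trace_integral K z g al i a b : flux_condition Gamma bm bp K g al ->
  (forall x, pieces Gamma K x -> z x = pwg K g al x) ->
  edge K i = segment a b ->
  let f s := dot (trace Gamma K z (lerp a b s)) (b - a) in
  leb.-integrable `[0, 1] (EFin \o f) /\
  \int[leb]_(s in `[0, 1]) f s = pw K g al b - pw K g al a.
Proof.
move=> fl zE e f.
have onK s : 0 <= s <= 1 -> elt K (lerp a b s).
  by move=> h; apply: (@edge_elt _ _ nd K i); rewrite e; exists s => //=; rewrite in_itv.
have [al0|al0] := eqVneq al 0.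
  have fE s : 0 <= s <= 1 -> f s = dot g (b - a).
    move=> h; rewrite /f (trace_pwg nd hcut (onK s h) zE); last by left.
    by rewrite al0 pwg0.
  have [|||fi ->] := @step_integral R f 0 (dot g (b - a)) (dot g (b - a)).
  - by rewrite lexx ler01.
  - by move=> s h _; exact: fE.
  - by move=> s h _; exact: fE.
  split=> //.
  by rewrite /pw al0 !mul0r !addr0 mulr0 add0r subr0 mulr1 dotBr.
have hK : interface_elt Gamma K.
  by apply: contrapT => /fl.1 h; rewrite h eqxx in al0.
have [s0 [s01 hl hr hv]] := affine_sign_change (cut_dist_ends nd hcut hK e).
have dE s : cut_dist K (lerp a b s) = (1 - s) * cut_dist K a + s * cut_dist K b.
  by rewrite P1_lerp//; exact: cut_dist_P1.
pose C x := dot (pwg K g al x) (b - a).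
have fE s x : 0 <= s <= 1 -> cut_dist K (lerp a b s) != 0 ->
    (0 < cut_dist K (lerp a b s)) = (0 < cut_dist K x) -> f s = C x.
  move=> h d0 sg; rewrite /f (trace_pwg nd hcut (onK s h) zE) ?(pwg_eq _ _ sg)//.
  by right; exact/eqP.
have [||fi ->] := @step_integral R f s0 (C a) (C b) s01.
- by move=> s h /hl - /(_ h)[]; rewrite -dE => h1 h2; exact: fE.
- by move=> s h /hr - /(_ h)[]; rewrite -dE => h1 h2; exact: fE.
split=> //.
have CE x : C x = dot g (b - a) +
    al * (if 0 < cut_dist K x then cut_dist K b - cut_dist K a else 0).
  rewrite /C /pwg dotDl dotZl cut_distB; case: ifP => _; ring.
rewrite !CE /pw; move: hv; set u := (if _ then _ else _); set v := (if _ then _ else _).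
rewrite dotBr => hv; transitivity (dot g b - dot g a + al * (u * s0 + v * (1 - s0))).
  ring.
rewrite hv; ring.
Qed.

Lemma edge_jumpE K L i j z g al g' al' :
  flux_condition Gamma bm bp K g al -> flux_condition Gamma bm bp L g' al' ->
  (forall x, pieces Gamma K x -> z x = pwg K g al x) ->
  (forall x, pieces Gamma L x -> z x = pwg L g' al' x) ->
  edge K i = edge L j ->
  edge_jump Gamma K L i z =
    pw K g al (vtx K (i - 1)) - pw K g al (vtx K (i + 1)) -
    (pw L g' al' (vtx K (i - 1)) - pw L g' al' (vtx K (i + 1))).
Proof.
move=> flK flL zK zL e; set a := vtx K (i + 1); set b := vtx K (i - 1).
have eK : edge K i = segment a b by [].
have eL : edge L j = segment a b by rewrite -e.
have [iK <-] := edge_trace_integral flK zK eK.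
have [iL <-] := edge_trace_integral flL zL eL.
rewrite -(RintegralB _ iK iL); last exact: measurable_itv.
by apply: eq_Rintegral => s _; rewrite dotBl.
Qed.

(** [w] is the gradient of the linear interpolant of [psi]: the gradients of the barycentric
    coordinates, weighted by the nodal values. *)
Lemma interpolation_gradient K (psi : R * R -> R) : exists w, forall i j,
  dot w (vtx K j - vtx K i) = psi (vtx K j) - psi (vtx K i).
Proof.
have /choice[c /choice[g gE]] : forall k, exists c g, forall x, bary K k x = c + dot g x.
  by move=> k; exact: bary_P1.
exists (\sum_k psi (vtx K k) *: g k) => i j.
have E x : dot (\sum_k psi (vtx K k) *: g k) x =
    \sum_k psi (vtx K k) * bary K k x - \sum_k psi (vtx K k) * c k.
  by rewrite !sum_ord3 !gE !dotDl !dotZl; ring.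
have V l : \sum_k psi (vtx K k) * bary K k (vtx K l) = psi (vtx K l).
  rewrite (bigD1 l)//= bary_vtx// eqxx mulr1 big1 ?addr0// => k kl.
  by rewrite bary_vtx// (negPf kl) mulr0.
by rewrite dotBr !E !V; ring.
Qed.

End edges.

(** * The two inclusions of the exact sequence *)

Section exactness.
Variables (R : realType) (Omega Gamma Om Op : set (R * R)) (mum mup bm bp : R)
  (M : mesh R).
Implicit Types (K L : 'I_(nelt M)) (i j : 'I_3) (x y a b g : R * R) (c al : R).
Hypothesis hO : polygonal_domain Omega.
Hypothesis hG : Gamma `<=` Omega.
Hypotheses (hmum : 0 < mum) (hmup : 0 < mup).
Hypothesis hM : triangulation M Omega.
Hypothesis hcut : cut_by_interface M Gamma Om Op.
Let nd := triangulation_orient hM.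
Let Oo : open Omega. Proof. by case: hO. Qed.
Notation leb := (@lebesgue_measure R).


Lemma IND_loc_curl z : (forall K, IND_loc Gamma mum mup bm bp K z) ->
  piecewise_const M Gamma (curl z).
Proof.
move=> h K; have [hI hN] := h K; split=> hK.
  have [vm [vp [[am [bm' vmE]] [ap [bp' vpE]] _ gl]]] := hI hK.
  exists (- (2 * bm')), (- (2 * bp')) => x xK.
  have nK : nbhs x (elt K)° by apply: open_nbhs_nbhs; split=> //; exact: open_interior.
  have dc := P1_continuous (cut_dist_P1 K).
  split=> d; [apply: (@curl_ND _ _ am)|apply: (@curl_ND _ _ ap)].
    by apply: filterS2 nK (near_lt (@dc x) d) => y yK yd; rewrite (gl y yK).1.
  by apply: filterS2 nK (near_gt (@dc x) d) => y yK yd; rewrite (gl y yK).2.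
have [w [[a [b wE]] zw]] := hN hK.
exists (- (2 * b)) => x xK; apply: (@curl_ND _ _ a).
have nK : nbhs x (elt K)° by apply: open_nbhs_nbhs; split=> //; exact: open_interior.
by apply: filterS nK => y yK; rewrite zw.
Qed.

(** By [cut_dist_bdry], a kinked element has no zero of [cut_dist] on a boundary edge; opposite
    signs at [x] and [y] would produce one by linear interpolation. Hence [pw] is affine along
    boundary edges, and its values at the ends decide the trace. *)
Lemma bdry_edge_side K g al i x y : flux_condition Gamma bm bp K g al ->
  edge K i `<=` bdry Omega -> edge K i x -> edge K i y ->
  smooth_at K al x /\
  (al = 0 \/ (0 < cut_dist K x) = (0 < cut_dist K y)).
Proof.
move=> fl eb xe ye; have [->|al0] := eqVneq al 0; first by split; left.
have hK : interface_elt Gamma K.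
  by apply: contrapT => /fl.1 h; rewrite h eqxx in al0.
have nz := cut_dist_bdry nd hcut Oo hG hK eb.
split; [right; exact/eqP/nz|right].
have [s0 [s01 hl hr _]] := affine_sign_change (or_introl (nz x xe)
  : cut_dist K x != 0 \/ cut_dist K y != 0).
have xy s : 0 <= s <= 1 -> (1 - s) * cut_dist K x + s * cut_dist K y != 0.
  move=> s1; rewrite -(P1_lerp x y s (cut_dist_P1 K)); apply: nz.
  have [xK xi] := (edgeP nd K i x).1 xe; have [yK yi] := (edgeP nd K i y).1 ye.
  apply/(edgeP nd); split; first exact: (elt_lerp nd).
  by rewrite P1_lerp ?xi ?yi ?mulr0 ?addr0//; exact: bary_P1.
have nx := nz x xe; have ny := nz y ye.
case: (ltP 0 (cut_dist K x)) => h; case: (ltP 0 (cut_dist K y)) => h' //.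
  have d : 0 < cut_dist K x - cut_dist K y by lra.
  have := xy (cut_dist K x / (cut_dist K x - cut_dist K y)).
  rewrite divr_ge0 ?(ltW d) ?(ltW h)// ler_pdivrMr// mul1r lerBrDr gerDl h' => /(_ isT).
  rewrite (_ : _ + _ = 0) ?eqxx//; field; exact: lt0r_neq0.
have d : 0 < cut_dist K y - cut_dist K x by lra.
have := xy (- cut_dist K x / (cut_dist K y - cut_dist K x)).
rewrite divr_ge0 ?(ltW d) ?oppr_ge0// ler_pdivrMr// mul1r lerDr (ltW h') => /(_ isT).
rewrite (_ : _ + _ = 0) ?eqxx//; field; exact: lt0r_neq0.
Qed.

Lemma increments_eq (k l r s r' s' : R) :
  k + r = l + s -> k + r' = l + s' -> r' - r - (s' - s) = 0.
Proof. by move=> h1 h2; lra. Qed.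

Lemma grad_Sh0 z u : Sh0 M Omega Gamma bm bp u -> eq_pieces M Gamma z (grad u) ->
  IND0 M Omega Gamma mum mup bm bp z /\ eq_pieces M Gamma (curl z) (cst 0).
Proof.
move=> [[hloc hnode] hb] zu.
have /choice[c /choice[g /choice[al H]]] : forall K, exists c g al,
    flux_condition Gamma bm bp K g al /\
    forall x, pieces Gamma K x -> u x = c + pw K g al x.
  by move=> K; exact: (pw_Sh_loc hcut (hloc K)).
have fl K := (H K).1; have uE K := (H K).2.
have zE K x : pieces Gamma K x -> z x = pwg K (g K) (al K) x.
  by move=> xp; rewrite (zu K x xp) (grad_pieces (fl K) (uE K)).
have tE K x : elt K x ->
    trace Gamma K (u : R * R -> R^o) x = c K + pw K (g K) (al K) x.
  by move=> xK; exact: (trace_pw nd hcut xK (uE K)).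
split; last by move=> K x xp; exact: (curl_pieces (fl K) (zE K) xp).
split; last first.
  move=> K i eb x xe.
  have [e1 e2] := edgeS K i.
  have [sx _] := bdry_edge_side (fl K) eb xe xe.
  have xK := edge_elt nd xe.
  rewrite (trace_pwg nd hcut xK (zE K) sx).
  have [_ s1] := bdry_edge_side (fl K) eb e1 xe.
  have [_ s2] := bdry_edge_side (fl K) eb e2 xe.
  (* The trace of [u] vanishes at both ends of the edge, so the affine function [pw] has equal
     values there and its gradient no tangential component. *)
  have := pwB (g K) s1; have := pwB (g K) s2; rewrite !dotBr.
  have := hb K i eb _ e1; have := hb K i eb _ e2.
  rewrite !tE ?(edge_elt nd e1) ?(edge_elt nd e2)//; try exact: (edge_elt nd e1);
    try exact: (edge_elt nd e2).
  lra.
split=> [K|K L i j KL e]; first exact: (IND_loc_pwg mum mup hcut (fl K) (zE K)).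
rewrite (edge_jumpE nd hcut (fl K) (fl L) (zE K) (zE L) e).
have vK k : elt K (vtx K k) by exact: (vtx_elt nd).
(* Nodal continuity read through the normal forms; the constants [c K] and [c L] cancel in the
   increments along the edge. *)
have node k k' : vtx K k = vtx L k' ->
    c K + pw K (g K) (al K) (vtx K k) = c L + pw L (g L) (al L) (vtx K k).
  move=> ek; rewrite -tE// (hnode _ _ _ _ ek) tE// ek; exact: (vtx_elt nd).
have [[e1 e2]|[e1 e2]] := segment_ends e.
  exact: increments_eq (node _ _ e1) (node _ _ e2).
exact: increments_eq (node _ _ e1) (node _ _ e2).
Qed.

Lemma potential_IND0 z : IND0 M Omega Gamma mum mup bm bp z ->
  eq_pieces M Gamma (curl z) (cst 0) ->
  exists u, Sh0 M Omega Gamma bm bp u /\ eq_pieces M Gamma z (grad u).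
Proof.
move=> [[hloc hjump] hb] z0.
have /choice[g /choice[al H]] : forall K, exists g al,
    flux_condition Gamma bm bp K g al /\
    forall x, pieces Gamma K x -> z x = pwg K g al x.
  by move=> K; exact: (pwg_IND_loc nd hcut hmum hmup (hloc K) (z0 K)).
have fl K := (H K).1; have zE K := (H K).2.
pose psi K := pw K (g K) (al K).
(* The edge conditions involve [psi K] only through its vertex values, so the kinked function may be
   replaced by its linear interpolant, whose gradient is constant on the element. *)
have /choice[w wE] : forall K, exists w, forall i j,
    dot w (vtx K j - vtx K i) = psi K (vtx K j) - psi K (vtx K i).
  by move=> K; exact: (interpolation_gradient nd).
have w_shared K L i j : K <> L -> edge K i = edge L j ->
    dot (w K) (vtx K (i - 1) - vtx K (i + 1)) =
    dot (w L) (vtx K (i - 1) - vtx K (i + 1)).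
  move=> KL e.
  have := hjump K L i j KL e.
  rewrite (edge_jumpE nd hcut (fl K) (fl L) (zE K) (zE L) e) wE => /subr0_eq ->.
  by have [[-> ->]|[-> ->]] := segment_ends e; rewrite wE.
have w_bdry K i : edge K i `<=` bdry Omega ->
    dot (w K) (vtx K (i - 1) - vtx K (i + 1)) = 0.
  move=> eb; have eK : edge K i = segment (vtx K (i + 1)) (vtx K (i - 1)) by [].
  have [_ IK] := edge_trace_integral nd hcut (fl K) (zE K) eK.
  rewrite wE -IK; transitivity (\int[leb]_(s in `[0, 1]) (0 : R)).
    apply: eq_Rintegral => s; rewrite inE /= => s01; apply: (hb K i eb).
    by exists s.
  by rewrite Rintegral_cst//= mul0r.
have [U [UK Ub]] := mesh_potential hM hO w_shared w_bdry.
(* This constant matches [k K + psi K] with the global potential [U] at vertex 0; the increments of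
   [U] then give the match at the other vertices, which is [vE]. *)
pose k K := U (vtx K 0) - psi K (vtx K 0).
(* Interiors of distinct elements are disjoint, so the choice is immaterial; the default 0 is taken
   only outside all interiors, where no value is ever used. *)
pose u x := if [pick K | `[< (elt K)° x >]] is Some K then k K + psi K x else 0.
have uE K x : pieces Gamma K x -> u x = k K + psi K x.
  move=> [xK _]; rewrite /u; case: pickP => [L /asboolP xL|/(_ K)/asboolP//].
  have [->//|/eqP KL] := eqVneq K L.
  have := interior_subset xL; have := interior_subset xK => xK' xL'.
  case: (elt_meet hM KL xK' xL') => -[i [j]].
    move=> [_ _ xE]; have [l vl] := vtx_edge K i.
    by case: (interior_edge nd xK (i := l)); rewrite xE.
  by move=> [_ _ /(interior_edge nd xK)].
have tE K x : elt K x -> trace Gamma K (u : R * R -> R^o) x = k K + psi K x.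
  by move=> xK; exact: (trace_pw nd hcut xK (uE K)).
have vE K i : k K + psi K (vtx K i) = U (vtx K i).
  have := UK K _ _ (vtx_elt nd K 0) (vtx_elt nd K i).
  by rewrite wE /k => e; lra.
exists u; split; last first.
  by move=> K x xp; rewrite (zE K x xp) (grad_pieces (fl K) (uE K) xp).
split; last first.
  move=> K i eb x xe; rewrite tE; last exact: (edge_elt nd xe).
  have [e1 e2] := edgeS K i.
  have [sx s1] := bdry_edge_side (fl K) eb xe e1.
  have [_ s2] := bdry_edge_side (fl K) eb e2 e1.
  have := pwB (g K) s1; have := pwB (g K) s2.
  (* The trace is affine along the boundary edge and takes at its ends the values of [U], which are
     0. *)
  have := Ub _ (eb _ e1); have := Ub _ (eb _ e2); rewrite -!vE /psi.
  set G := pwg _ _ _ _; case: xe => s _ <-.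
  have -> : lerp (vtx K (i + 1)) (vtx K (i - 1)) s - vtx K (i + 1) =
    s *: (vtx K (i - 1) - vtx K (i + 1)).
    by rewrite -[X in _ - X](lerp0 _ (vtx K (i - 1))) lerpB subr0.
  rewrite dotZr => h1 h2 <- h3.
  have h4 : pw K (g K) (al K) (vtx K (i - 1)) = pw K (g K) (al K) (vtx K (i + 1)) by lra.
  by move: h3; rewrite h4 subrr mulr0; lra.
split=> [K|K L i j e]; first exact: (Sh_loc_pw hcut (fl K) (uE K)).
rewrite !tE; [|by rewrite e; exact: (vtx_elt nd)|exact: (vtx_elt nd)].
by rewrite vE e vE.
Qed.

End exactness.

Theorem theorem3p5 (R : realType) (Omega Gamma Om Op : set (R * R))
    (mum mup bm bp : R) (M : mesh R)
    (hOmega : polygonal_domain Omega)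
    (hOmega_sc : simply_connected Omega)
    (hGamma : smooth_jordan_curve Gamma)
    (hGamma_sub : Gamma `<=` Omega)
    (hsep : separates Gamma Omega Om Op)
    (hmum : 0 < mum) (hmup : 0 < mup) (hbm : 0 < bm) (hbp : 0 < bp)
    (hM : triangulation M Omega)
    (hang : no_obtuse_angle M)
    (hcut : cut_by_interface M Gamma Om Op) :
  (forall z : R * R -> R * R,
     IND0 M Omega Gamma mum mup bm bp z -> piecewise_const M Gamma (curl z)) /\
  (forall z : R * R -> R * R,
     (exists u : R * R -> R,
        Sh0 M Omega Gamma bm bp u /\ eq_pieces M Gamma z (grad u)) <->
     (IND0 M Omega Gamma mum mup bm bp z /\
      eq_pieces M Gamma (curl z) (cst 0))).

Proof.
split; first by move=> z [[h _] _]; exact: IND_loc_curl h.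
move=> z; split=> [[u [hu zu]]|[hz z0]]; first
  exact: (grad_Sh0 mum mup hOmega hGamma_sub hM hcut hu zu).
exact: (potential_IND0 hOmega hGamma_sub hmum hmup hM hcut hz z0).
Qed.
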